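(* Let $K$ be a field, let $\mathcal{V}=\{1,\ldots,n\}$, let $R=K[x_1,\ldots,x_n]$, and let $\mathcal{H}=(\mathcal{V},\mathcal{E})$ be a balanced hypergraph with $\mathcal{E}\neq\emptyset$. Then the depth function of the cover ideal $J(\mathcal{H})\subseteq R$ is non-increasing, i.e. $$\operatorname{depth} R/J(\mathcal{H})^t\geqslant \operatorname{depth} R/J(\mathcal{H})^{t+1}\quad\text{for all integers } t\geqslant 1.$$
   Context: A hypergraph $\mathcal{H}=(\mathcal{V},\mathcal{E})$ on the vertex set $\mathcal{V}=\{1,\ldots,n\}$ consists of $\mathcal{V}$ and a family $\mathcal{E}$ of distinct nonempty subsets of $\mathcal{V}$, called edges. A cycle of length $k$ in $\mathcal{H}$ is a sequence $(i_1,E_1,i_2,E_2,\ldots,i_k,E_k,i_1)$ where $E_1,\ldots,E_k$ are distinct edges, $i_1,\ldots,i_k$ are distinct vertices, $\{i_t,i_{t+1}\}\subseteq E_t$ for $t=1,\ldots,k-1$, and $\{i_k,i_1\}\subseteq E_k$. The hypergraph $\mathcal{H}$ is balanced if every cycle of odd length $k\geqslant 3$ has an edge (among $E_1,\ldots,E_k$) containing at least three of the vertices $i_1,\ldots,i_k$ of the cycle. Equivalently, the incidence matrix of $\mathcal{H}$ (rows indexed by edges, columns by vertices, entry $1$ if the vertex lies in the edge and $0$ otherwise) has, up to permuting rows and columns, no $k\times k$ submatrix with $k\geqslant 3$ odd whose entries are $1$ at positions $(a,a)$ for $1\le a\le k$, $(a,a+1)$ for $1\le a\le k-1$, and $(k,1)$,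 and $0$ elsewhere. A vertex cover of $\mathcal{H}$ is a subset of $\mathcal{V}$ meeting every edge of $\mathcal{H}$; it is minimal if no proper subset is a vertex cover. The cover ideal of $\mathcal{H}$ is $$J(\mathcal{H})=\Big(\prod_{i\in\tau}x_i \;\Big|\; \tau \text{ is a minimal vertex cover of } \mathcal{H}\Big)=\bigcap_{E\in\mathcal{E}}(x_i\mid i\in E)\subseteq R.$$ For a finitely generated graded nonzero $R$-module $M$, $\operatorname{depth} M$ is the length of a maximal homogeneous $M$-sequence in $\mathfrak{m}=(x_1,\ldots,x_n)$; equivalently $\operatorname{depth} M=\min\{i\mid H^i_{\mathfrak m}(M)\neq 0\}$, where $H^i_{\mathfrak m}$ denotes local cohomology with respect to $\mathfrak m$. The depth function of a homogeneous ideal $I$ is $t\mapsto \operatorname{depth} R/I^t$, $t\geqslant 1$. *)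

(* Defs.v *)
From Stdlib Require Import ClassicalEpsilon.
From mathcomp Require Import all_boot all_order all_algebra.
From mathcomp Require Export mpoly.

Set Implicit Arguments.
Unset Strict Implicit.
Unset Printing Implicit Defensive.

Import GRing.Theory.
Local Open Scope ring_scope.

(* The vertex set {1, ..., n} is represented by 'I_n. *)
Record hypergraph (n : nat) := Hypergraph {
  edges : {set {set 'I_n}};
  edges_nonempty : set0 \notin edges
}.

(* [ordS] is the cyclic successor on 'I_k, so the last edge of the cycle
   contains the last and the first vertex. *)
Definition is_cycle (n : nat) (H : hypergraph n) (k : nat)
    (v : 'I_k -> 'I_n) (F : 'I_k -> {set 'I_n}) : Prop :=
  [/\ injective v, injective F,
      forall a, F a \in edges H &
      forall a, [set v a; v (ordS a)] \subset F a].

Definition balanced (n : nat) (H : hypergraph n) : Prop :=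
  forall (k : nat) (v : 'I_k -> 'I_n) (F : 'I_k -> {set 'I_n}),
    odd k -> (3 <= k)%N -> is_cycle H v F ->
    exists a, (3 <= #|F a :&: [set v b | b : 'I_k]|)%N.

Definition vertex_cover (n : nat) (H : hypergraph n) (tau : {set 'I_n}) : bool :=
  [forall F in edges H, tau :&: F != set0].

Section Ideals.
Variable R : comNzRingType.

(* Ideals are represented by their membership predicates. *)
Definition ideal_span (S : R -> Prop) (f : R) : Prop :=
  exists s : seq (R * R),
    (forall p, p \in s -> S p.2) /\ f = \sum_(p <- s) p.1 * p.2.

Definition ideal_pow (I : R -> Prop) (t : nat) : R -> Prop :=
  ideal_span (fun f =>
    exists s : t.-tuple R, (forall g, g \in s -> I g) /\ f = \prod_(g <- s) g).

(* The ideal I + (s); its image in R/I is the submodule s(R/I). *)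
Definition ideal_adjoin (I : R -> Prop) (s : seq R) : R -> Prop :=
  ideal_span (fun f => I f \/ f \in s).

(* s is an (R/I)-sequence: each s_j is a nonzerodivisor on
   R/(I + (s_0, ..., s_(j-1))), and R/I <> s(R/I). *)
Definition quotient_regular_seq (I : R -> Prop) (s : seq R) : Prop :=
  (forall j, (j < size s)%N -> forall g,
     ideal_adjoin I (take j s) (s`_j * g) -> ideal_adjoin I (take j s) g) /\
  ~ ideal_adjoin I s 1.

End Ideals.

Section Depth.
Variables (K : fieldType) (n : nat).
Local Notation R := {mpoly K[n]}.

Definition cover_ideal (H : hypergraph n) : R -> Prop :=
  ideal_span (fun f =>
    exists2 tau, minset (vertex_cover H) tau & f = \prod_(i in tau) 'X_i).

Definition irrelevant_ideal : R -> Prop :=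
  ideal_span (fun f => exists i, f = 'X_i).

Definition homogeneous_quotient_seq (I : R -> Prop) (s : seq R) : Prop :=
  (forall f, f \in s ->
     (exists d : nat, f \is d.-homog) /\ irrelevant_ideal f) /\
  quotient_regular_seq I s.

Definition maximal_homogeneous_quotient_seq (I : R -> Prop) (s : seq R) : Prop :=
  homogeneous_quotient_seq I s /\
  forall f, ~ homogeneous_quotient_seq I (rcons s f).

(* depth R/I.  For a proper homogeneous ideal I, maximal homogeneous
   (R/I)-sequences in the irrelevant ideal exist and all have the same
   length, so [epsilon] picks that length; otherwise the value is not
   meaningful. *)
Definition depth_quotient (I : R -> Prop) : nat :=
  epsilon (inhabits 0%N)
    (fun d => exists2 s, maximal_homogeneous_quotient_seq I s & size s = d).

End Depth.

Arguments cover_ideal K {n} H _.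

(* Main.v *)
From Stdlib Require Import ClassicalEpsilon FunctionalExtensionality PropExtensionality.
Require Import Defs.
From mathcomp Require Import all_boot all_order all_algebra.
From mathcomp Require Import ring zify.

(** Let J be the cover ideal. The proof compares the Koszul homology of R/J^t
    and R/J^(t+1) with respect to the powers x_i^N of the variables, for one
    suitable exponent N, multidegree by multidegree.

    Depth and Koszul homology. If f in the irrelevant ideal is a nonzerodivisor
    on R/I, then the largest degree in which the Koszul homology of R/I does not
    vanish goes up by one when I is replaced by I + (f)
    ([acyclic_from_adjoin1]). Since that degree never exceeds n, an
    (R/I)-sequence of length d forces it to be at most n - d. Conversely, let s
    be a maximal sequence of length d. If the homology of R/I vanished from
    degree n - d on, then H_n would vanish for R/(I + (s)), that is, no nonzero
    element of this quotient would be killed by all x_i^N; a homogeneous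
    nonzerodivisor then exists ([exists_regular_element]) and s could be
    prolonged. The nonzerodivisor comes from the ascending chain condition
    applied to a sequence of forms any two of which generate, up to radical,
    the same ideal ([saturation_avoidance_pair]). So it suffices to show that
    vanishing of the Koszul homology of R/J^(t+1) in a degree implies its
    vanishing for R/J^t ([acyclic_symbolicS]).

    Combinatorics. A balanced hypergraph has good colourings: any nonnegative
    integer weight a on the vertices is a sum of t weights, the colours, such
    that each edge of weight at least t meets all colours and each edge of
    weight at most t meets each colour at most once ([balanced_colouring]). This
    reduces to colourings with two colours, for which Berge's argument works:
    the graph of edges of size two is bipartite, and a vertex that does not
    separate its neighbours in this graph can be removed and put back.

    Good colourings enter twice. They show that J^t is spanned by the monomials
    of weight at least t on every edge ([cover_pow_symbolic]). And they match
    multidegrees: adding one colour to an exponent vector a raises the weight of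
    every edge of weight at least t by at least one, and that of every edge of
    weight less than t by at most one, so an edge has weight less than t before
    if and only if it has weight less than t + 1 after. In this way each
    multidegree A has a partner B in which the Koszul complex of R/J^(t+1) is
    the Koszul complex of R/J^t in multidegree A ([matching_multidegree]). *)

Set Implicit Arguments.
Unset Strict Implicit.
Unset Printing Implicit Defensive.

Import Order.TTheory GRing.Theory.

(** * Two-colourings of balanced hypergraphs *)

Section NonCut.
Variables (T : finType) (e : rel T).
Hypotheses (e_sym : symmetric e) (e_irr : irreflexive e).

Definition avoiding (x : T) : rel T := fun a b => [&& a != x, b != x & e a b].

(** Among the pairs of adjacent vertices x, r take one for which the component
    of r in the graph without x is as large as possible. A neighbour y of x
    outside that component would do better: without y, the vertex x itself joins
    the component of r. *)
Lemma noncut_vertex (S : {set T}) : S != set0 ->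
    (forall x y, e x y -> x \in S) ->
  exists2 x, x \in S &
    forall y y', e x y -> e x y' -> connect (avoiding x) y y'.
Proof.
move=> /set0Pn [x0 x0S] eS.
have [/existsP [[x1 r1] /= e1] | /existsPn noe] :=
    boolP [exists p : T * T, e p.1 p.2]; last first.
  by exists x0 => // y y' exy; have := noe (x0, y); rewrite /= exy.
pose reach (p : T * T) := [set z | connect (avoiding p.1) p.2 z].
case: (@arg_maxnP _ (x1, r1) (fun p => e p.1 p.2) (fun p => #|reach p|) e1).
move=> [x r] /= exr xmax.
have key y : e x y -> connect (avoiding x) r y.
  move=> exy; apply: contraT => nry.
  have eyx : e y x by rewrite e_sym.
  have := xmax (y, x) eyx; rewrite leqNgt => /negP []; apply: proper_card.
  have neq a b : e a b -> a != b.
    by move=> eab; apply: contraTneq eab => ->; rewrite e_irr.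
  have ry : r != y by apply: contraNneq nry => ->; rewrite connect0.
  have xr : connect (avoiding y) x r.
    by apply: connect1; rewrite /avoiding (neq _ _ exy) ry exr.
  apply/properP; split; last first.
    exists x; rewrite !inE ?connect0 //=; apply/negP => /connectP [p].
    case/lastP: p => [_ /eqP|p z]; first by rewrite (negPf (neq _ _ exr)).
    by rewrite rcons_path last_rcons => /andP [_ /and3P [_ zx _]] xz; rewrite xz eqxx in zx.
  apply/subsetP => z; rewrite !inE => /connectP [p]; elim/last_ind: p z => [|p b IHp] z /=.
    by move=> _ ->.
  rewrite rcons_path last_rcons => /andP [pp eb] ->.
  apply: (connect_trans (IHp _ pp erefl)); apply: connect1.
  have rp : connect (avoiding x) r (last r p) by apply/connectP; exists p.
  have rb : connect (avoiding x) r b by apply: connect_trans rp (connect1 eb).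
  have ny w : connect (avoiding x) r w -> w != y.
    by move=> rw; apply: contraNneq nry => <-.
  by case/and3P: eb => _ _ eb; rewrite /avoiding !ny.
exists x => [|y y' exy exy']; first exact: eS exr.
apply: connect_trans (key _ exy').
rewrite (sym_connect_sym _) ?key //.
by move=> a b; rewrite /avoiding e_sym andbCA.
Qed.

End NonCut.

Lemma modn_add2_neq m k : 2 < m -> k < m -> k.+2 %% m != k.
Proof.
move=> m2 km; have [lt2|] := ltnP k.+2 m; first by rewrite modn_small //; lia.
rewrite leq_eqVlt => /orP [/eqP Em|lt2]; first by rewrite -Em modnn; lia.
have -> : k.+2 = 1 + m by lia.
by rewrite modnDr modn_small; lia.
Qed.

Section Bicolouring.
Variables (n : nat) (H : hypergraph n).
Hypothesis balH : balanced H.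

Section Trace.
Variable S : {set 'I_n}.

(** The edges that constrain a two-colouring of S most: both their vertices in S
    must differ in colour. *)
Definition trace_edge : rel 'I_n :=
  fun x y => (x != y) && [exists E in edges H, E :&: S == [set x; y]].

Lemma trace_edge_sym : symmetric trace_edge.
Proof. by move=> x y; rewrite /trace_edge eq_sym setUC. Qed.

Lemma trace_edge_irr : irreflexive trace_edge.
Proof. by move=> x; rewrite /trace_edge eqxx. Qed.

Lemma trace_edgeP x y : trace_edge x y ->
  exists E, [/\ E \in edges H, E :&: S = [set x; y] & x != y].
Proof. by case/andP => xy /existsP [E /andP [EH /eqP ES]]; exists E. Qed.

Lemma trace_edge_inl x y : trace_edge x y -> x \in S.
Proof.
case/trace_edgeP => E [_ ES _].
have : x \in E :&: S by rewrite ES !inE eqxx.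
by rewrite inE => /andP [].
Qed.

(** All vertices of the cycle lie in S, so an edge of H realising one of its steps
    contains just the two vertices of that step. Balancedness forbids this for
    odd length. *)
Lemma no_odd_trace_cycle (c : seq 'I_n) :
  cycle trace_edge c -> uniq c -> odd (size c) -> 3 <= size c -> False.
Proof.
move=> cyc unc oddc szc.
case: c cyc unc oddc szc => // x q cyc unc oddc szc.
set c := x :: q in cyc unc oddc szc *.
(* The cycle c as a cycle of H, with one edge of H chosen for each step. *)
pose v (a : 'I_(size c)) := nth x c a.
have vinj : injective v.
  by move=> a b /eqP; rewrite nth_uniq // => /eqP /val_inj.
have ev a : trace_edge (v a) (v (ordS a)).
  have /(pathP x) /(_ a) := cyc; rewrite size_rcons => /(_ (ltn_ord a)).
  rewrite nth_rcons.
  have -> : nth x (x :: rcons q x) a = v a.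
    by rewrite /v -rcons_cons nth_rcons ltn_ord.
  suff -> : v (ordS a) = if a < size q then nth x q a else
    if a == size q :> nat then x else x by [].
  rewrite /v /=; have := ltn_ord a; rewrite /= ltnS leq_eqVlt => /orP [/eqP ->|lta].
    by rewrite modnn ltnn eqxx.
  by rewrite modn_small ?lta ?ltnS.
have vS a : v a \in S by exact: trace_edge_inl (ev a).
pose F a := xchoose (existsP (proj2 (andP (ev a)))).
have FP a : F a \in edges H /\ F a :&: S = [set v a; v (ordS a)].
  by have /andP [? /eqP] := xchooseP (existsP (proj2 (andP (ev a)))).
have Fsub a : [set v a; v (ordS a)] \subset F a.
  by rewrite -(proj2 (FP a)) subsetIl.
(* Equal edges have the same trace on S, and distinct steps of a cycle of length
   at least 3 have distinct pairs of ends. *)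
have Finj : injective F.
  move=> a b Fab; have := proj2 (FP a); rewrite Fab (proj2 (FP b)) => /setP Eab.
  have := Eab (v a); rewrite !inE eqxx /= => /orP [/eqP /vinj //|/eqP /vinj ab].
  have := Eab (v (ordS a)); rewrite !inE eqxx orbT => /orP [/eqP /vinj sab|/eqP /vinj sab].
    have /(congr1 val) /= := sab; rewrite ab /= -[_.+1]addn1 modnDml addn1.
    by move/eqP; rewrite (negPf (modn_add2_neq szc (ltn_ord b))).
  by apply: (can_inj (@ordSK _)) ; rewrite sab.
have [|a] := @balH (size c) v F oddc szc.
  by split=> // a; case: (FP a).
rewrite leqNgt => /negP []; rewrite ltnS.
have /subset_leq_card : F a :&: [set v b | b : 'I_(size c)] \subset F a :&: S.
  by apply: setIS; apply/subsetP => w /imsetP [b _ ->].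
move=> /leq_trans; apply; rewrite (proj2 (FP a)) cards2.
by case: (_ != _).
Qed.

End Trace.

(** Induction on S. Remove a vertex x that does not separate its neighbours in the
    graph [trace_edge] and colour the rest. An edge with three vertices in S
    keeps two after the removal and stays two-coloured; an edge with trace
    {x, y} only asks that x and y differ. Two neighbours of x have the same
    colour: colours alternate along a path from one to the other avoiding x, and
    that path closes through x to a cycle, which cannot be odd. Hence x can take
    the other colour. *)
Lemma balanced_bicolouring (S : {set 'I_n}) :
  exists c : pred 'I_n, forall E, E \in edges H -> 2 <= #|E :&: S| ->
    (exists2 x, x \in E :&: S & c x) /\ (exists2 x, x \in E :&: S & ~~ c x).
Proof.
have [m] := ubnP #|S|; elim: m S => // m IHm S; rewrite ltnS => leSm.
have [->|S0] := eqVneq S set0.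
  by exists xpred0 => E _; rewrite setI0 cards0.
have [x xS noncut] := noncut_vertex (@trace_edge_sym S) (@trace_edge_irr S) S0
  (@trace_edge_inl S).
have [|c cP] := IHm (S :\ x).
  by apply: leq_trans leSm; rewrite [X in _ < X](cardsD1 x) xS.
have cS E y : y \in E :&: (S :\ x) -> y \in E :&: S.
  by rewrite !inE => /and3P [-> _ ->].
(* The trace {y, z} survives the removal of x, so c separates y and z. *)
have alt y z : avoiding (trace_edge S) x y z -> c z = ~~ c y.
  case/and3P => yx zx /trace_edgeP [E [EH ES yz]].
  have ESx : E :&: (S :\ x) = [set y; z].
    rewrite setIDA ES; apply/setDidPl; rewrite disjoint_sym disjoints1 !inE.
    by rewrite eq_sym (negPf yx) eq_sym (negPf zx).
  have := cP E EH; rewrite ESx cards2 yz => /(_ isT) [[a a1 ca] [b b1 cb]].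
  move: a1 b1; rewrite !inE => /orP [] /eqP Ea /orP [] /eqP Eb; subst;
    by [rewrite ca in cb | rewrite ?(negPf cb) ca].
have same y y' : trace_edge S x y -> trace_edge S x y' -> c y = c y'.
  move=> exy exy'; apply/eqP; apply: contraT => cyy'.
  have /connectP [p0 /shortenP [p pp unp _]] := noncut _ _ exy exy'.
  move=> {p0} lastp.
  have parity q z : path (avoiding (trace_edge S) x) z q -> c (last z q) = c z (+) odd (size q).
    elim: q z => [|w q IHq] z /=; first by rewrite addbF.
    by case/andP => /alt czw /IHq ->; rewrite czw addNb addbN.
  have xp : x \notin y :: p.
    apply/negP => xp.
    have : path (fun a b => b != x) y p.
      by apply: sub_path pp => a b /and3P [].
    rewrite path_sortedE; last by move=> a b d _ ->.
    rewrite inE in xp; case/orP: xp => [/eqP xy|xp].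
      by rewrite xy trace_edge_irr in exy.
    elim: p {pp unp lastp} xp => // w p IHp; rewrite inE => /orP [/eqP <- /=|/IHp h /=].
      by rewrite eqxx.
    by case/andP => /andP [_ ?] /path_sorted ?; apply: h; apply/andP.
  exfalso; apply: (@no_odd_trace_cycle S (x :: y :: p)).
  - rewrite /= rcons_path -lastp (trace_edge_sym S y') exy' andbT.
    rewrite exy; apply: sub_path pp => a b; by case/and3P.
  - by rewrite cons_uniq xp.
  - have := parity _ _ pp; rewrite -lastp /= negbK => h.
    by move: cyy'; rewrite h; case: (c y); case: odd.
  - case: p pp unp lastp xp => //= _ _ yy'; by rewrite yy' eqxx in cyy'.
exists (fun z => if z == x then ~~ [exists y, trace_edge S x y && c y] else c z).
move=> E EH ge2.
have [ge2' | lt2'] := leqP 2 #|E :&: (S :\ x)|.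
  have [[a a1 ca] [b b1 cb]] := cP E EH ge2'.
  split; [exists a | exists b]; rewrite ?cS //.
    by move: a1; rewrite !inE => /and3P [_ /negPf ->].
  by move: b1; rewrite !inE => /and3P [_ /negPf ->].
have xE : x \in E.
  apply: contraTT ge2 => xE; rewrite -ltnNge; apply: leq_trans lt2'.
  rewrite ltnS subset_leq_card //; apply/subsetP => y; rewrite !inE => /andP [yE ->].
  by rewrite yE andbT; apply: contraNneq xE => <-.
have ESx : E :&: S = x |: (E :&: (S :\ x)).
  by rewrite setIDA setD1K // inE xE.
have /eqP /cards1P [y Ey] : #|E :&: (S :\ x)| = 1.
  by move: ge2 lt2'; rewrite ESx cardsU1 !inE eqxx /= andbF; lia.
have xy : y != x.
  have : y \in E :&: (S :\ x) by rewrite Ey inE.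
  by rewrite !inE => /and3P [].
have exy : trace_edge S x y.
  by rewrite /trace_edge eq_sym xy; apply/existsP; exists E; rewrite EH ESx Ey eqxx.
have -> : [exists y, trace_edge S x y && c y] = c y.
  apply/existsP/idP => [[y' /andP [exy' cy']]|cy].
    by rewrite (same _ _ exy exy').
  by exists y; rewrite exy.
rewrite ESx Ey.
by case cy: (c y); split; [exists y|exists x|exists x|exists y];
  rewrite ?inE ?eqxx ?orbT ?(negPf xy) ?cy.
Qed.

End Bicolouring.

(** * Colourings of weighted vertices with t colours *)

Section Colouring.
Variables (n : nat) (H : hypergraph n).
Hypothesis balH : balanced H.

Definition weight (u : 'I_n -> nat) (E : {set 'I_n}) : nat := \sum_(i in E) u i.

Lemma weight_gt0 u (E : {set _}) i : i \in E -> 0 < u i -> 0 < weight u E.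
Proof. by move=> iE ui; rewrite /weight (bigD1 i) //= addn_gt0 ui. Qed.

(** A vertex of weight at least two gives some weight to both parts, so an edge
    through it is harmless. The remaining edges live on the vertices of weight
    one, which are two-coloured. *)
Lemma balanced_split (w : 'I_n -> nat) :
  exists u v : 'I_n -> nat, (forall i, u i + v i = w i) /\
    forall E, E \in edges H -> 2 <= weight w E -> 0 < weight u E /\ 0 < weight v E.
Proof.
have [c cP] := balanced_bicolouring balH [set i | w i == 1].
pose u i : nat := if w i == 1 then c i : nat else (0 < w i).
have ule i : u i <= w i.
  by rewrite /u; case: eqP => [->|_]; [exact: leq_b1 | case: (w i)].
exists u, (fun i => w i - u i); split=> [i|E EH W2]; first by rewrite subnKC.
have [/existsP [i /andP [iE wi]]|] := boolP [exists i in E, 2 <= w i].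
  have ui : u i = 1 by rewrite /u; case: eqP => [wi1|_]; [rewrite wi1 in wi | case: (w i) wi].
  by split; apply: (weight_gt0 iE); rewrite ui //; lia.
rewrite negb_exists_in => /forall_inP small.
have eqW : weight w E = #|E :&: [set i | w i == 1]|.
  rewrite /weight -sum1_card big_mkcond [RHS]big_mkcond; apply: eq_bigr => i _.
  rewrite !inE; case iE: (i \in E) => //=; have := small i iE.
  by case: eqP => [->|] //; lia.
have := cP E EH; rewrite -eqW => /(_ W2) [[x xE cx] [y yE cy]].
move: xE yE; rewrite !inE => /andP [xE wx] /andP [yE wy].
by split; [apply: (weight_gt0 xE)|apply: (weight_gt0 yE)];
   rewrite /u ?wx ?wy ?cx ?(negPf cy) // (eqP wy).
Qed.

(** Minimise the number of pairs of an edge and a colour it does not meet. If some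
    edge misses p but has weight at least two in q, redistribute p and q
    together by [balanced_split]: edges of joint weight at least two then meet
    both colours, lighter edges meet as many as before, so the number drops. *)
Lemma good_colouring (t : nat) (a : 'I_n -> nat) : 0 < t ->
  exists u : 'I_t -> 'I_n -> nat,
    (forall i, \sum_c u c i = a i) /\
    forall E, E \in edges H ->
      (forall c, weight (u c) E <= 1) \/ (forall c, 0 < weight (u c) E).
Proof.
move=> t0.
pose miss (u : 'I_t -> 'I_n -> nat) (E : {set 'I_n}) := \sum_c (weight (u c) E == 0).
pose defect u := \sum_(E in edges H) miss u E.
pose u0 (c : 'I_t) i := if c == Ordinal t0 then a i else 0.
have u0P i : \sum_c u0 c i = a i.
  by rewrite (bigD1 (Ordinal t0)) //= {1}/u0 eqxx big1 ?addn0 // => c /negPf h; rewrite /u0 h.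
have [m] := ubnP (defect u0); elim: m u0 u0P => // m IHm u uP; rewrite ltnS => ltm.
have [/existsP [E /andP [EH /existsP [p /existsP [q /andP [p0 q2]]]]]|] := boolP
  [exists E in edges H, exists p, exists q, (weight (u p) E == 0) && (1 < weight (u q) E)];
  last first.
  rewrite negb_exists_in => /forall_inP good; exists u; split=> // E EH.
  have := good E EH; rewrite negb_exists => /forallP gE.
  have [/existsP [p p0]|] := boolP [exists p, weight (u p) E == 0].
    left=> c; have := gE p; rewrite negb_exists => /forallP /(_ c).
    by rewrite p0 /= -leqNgt.
  by rewrite negb_exists => /forallP h; right=> c; rewrite lt0n.
have qp : q != p by apply: contraTneq q2 => ->; rewrite (eqP p0).
have [x [y [xy xyP]]] := balanced_split (fun i => u p i + u q i).
pose u' c := if c == p then x else if c == q then y else u c.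
(* Only the two terms at p and q change, and each sum is cut accordingly. *)
have split_pq (F : 'I_t -> nat) : \sum_c F c = F p + F q + \sum_(c | (c != p) && (c != q)) F c.
  by rewrite (bigD1 p) //= (bigD1 q) //= addnA.
have u'p : u' p = x by rewrite /u' eqxx.
have u'q : u' q = y by rewrite /u' eqxx (negPf qp).
have u'c c : (c != p) && (c != q) -> u' c = u c.
  by case/andP => /negPf cp /negPf cq; rewrite /u' cp cq.
have u'P i : \sum_c u' c i = a i.
  rewrite -uP !split_pq u'p u'q xy; congr (_ + _).
  by apply: eq_bigr => c h; rewrite u'c.
have wD F : weight (fun i => u p i + u q i) F = weight (u p) F + weight (u q) F.
  exact: big_split.
have wD' F : weight x F + weight y F = weight (u p) F + weight (u q) F.
  by rewrite -wD /weight -big_split /=; apply: eq_bigr => i _; rewrite xy.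
have missE v F : miss v F = (weight (v p) F == 0) + (weight (v q) F == 0)
    + \sum_(c | (c != p) && (c != q)) (weight (v c) F == 0) by exact: split_pq.
have rest F : \sum_(c | (c != p) && (c != q)) (weight (u' c) F == 0 : nat)
   = \sum_(c | (c != p) && (c != q)) (weight (u c) F == 0).
  by apply: eq_bigr => c h; rewrite u'c.
have miss_le F : F \in edges H -> miss u' F <= miss u F.
  move=> FH; rewrite !missE rest leq_add2r u'p u'q.
  by have := xyP F FH; have := wD' F; rewrite wD; lia.
have miss_lt : miss u' E < miss u E.
  rewrite !missE rest ltn_add2r u'p u'q.
  by have := xyP E EH; have := wD' E; rewrite wD; lia.
apply: (IHm u' u'P); apply: leq_trans ltm.
rewrite /defect (bigD1 E) //= [X in _ < X](bigD1 E) //= -addSn leq_add //.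
by apply: leq_sum => F /andP [FH _]; exact: miss_le.
Qed.

Lemma balanced_colouring (t : nat) (a : 'I_n -> nat) : 0 < t ->
  exists u : 'I_t -> 'I_n -> nat,
    (forall i, \sum_c u c i = a i) /\
    forall E, E \in edges H ->
      (t <= weight a E -> forall c, 0 < weight (u c) E) /\
      (weight a E <= t -> forall c, weight (u c) E <= 1).
Proof.
move=> /(good_colouring a) [u [ua uP]]; exists u; split=> // E EH.
have -> : weight a E = \sum_c weight (u c) E.
  by rewrite exchange_big; apply: eq_bigr => i _; rewrite ua.
have sum1 c : \sum_(c' < t | c' != c) 1 = t.-1.
  by rewrite sum1_card cardC1 card_ord.
case: (uP E EH) => h; split=> // ht c; rewrite (bigD1 c) //= in ht.
  have le1 : \sum_(c' < t | c' != c) weight (u c') E <= t.-1.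
    by rewrite -(sum1 c); apply: leq_sum => c' _.
  by have := leq_trans ht (leq_add (leqnn _) le1); have := ltn_ord c; lia.
have le2 : t.-1 <= \sum_(c' < t | c' != c) weight (u c') E.
  by rewrite -(sum1 c); apply: leq_sum => c' _; apply: h.
by have := leq_trans (leq_add (leqnn _) le2) ht; have := ltn_ord c; lia.
Qed.

End Colouring.

Local Open Scope ring_scope.

(** * Ideals as membership predicates *)

Section IdealTheory.
Variable R : comNzRingType.
Implicit Types (I : R -> Prop) (a b f g : R) (s : seq R).

Record is_ideal I : Prop := IsIdeal {
  ideal0 : I 0;
  idealD : forall a b, I a -> I b -> I (a + b);
  idealMl : forall a b, I b -> I (a * b) }.

Lemma ideal_mulr I a b : is_ideal I -> I a -> I (a * b).
Proof. by move=> HI Ia; rewrite mulrC; apply: idealMl. Qed.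

Lemma idealN I a : is_ideal I -> I a -> I (- a).
Proof. by move=> HI Ia; rewrite -mulN1r; apply: idealMl. Qed.

Lemma idealB I a b : is_ideal I -> I a -> I b -> I (a - b).
Proof. by move=> HI Ia Ib; apply: idealD => //; apply: idealN. Qed.

Lemma ideal_sum I (T : Type) (r : seq T) (P : pred T) (F : T -> R) :
  is_ideal I -> (forall i, P i -> I (F i)) -> I (\sum_(i <- r | P i) F i).
Proof. by move=> HI IF; apply: big_ind => //; [apply: ideal0 | apply: idealD]. Qed.

Lemma ideal_sum_in I (T : eqType) (r : seq T) (F : T -> R) :
  is_ideal I -> (forall i, i \in r -> I (F i)) -> I (\sum_(i <- r) F i).
Proof. by move=> HI IF; rewrite big_seq; apply: ideal_sum. Qed.

Lemma span_is_ideal (S : R -> Prop) : is_ideal (ideal_span S).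
Proof.
split=> [|a b [s [sS ->]] [t [tS ->]]|a b [s [sS ->]]].
- by exists [::]; rewrite big_nil.
- exists (s ++ t); rewrite big_cat; split=> // p; rewrite mem_cat.
  by case/orP => [/sS|/tS].
- exists [seq (a * p.1, p.2) | p <- s]; rewrite big_map mulr_sumr; split.
    by move=> _ /mapP [p /sS Sp ->].
  by apply: eq_bigr => p _; rewrite mulrA.
Qed.

Lemma mem_span (S : R -> Prop) f : S f -> ideal_span S f.
Proof.
move=> Sf; exists [:: (1, f)]; rewrite big_seq1 mul1r; split=> // p.
by rewrite inE => /eqP ->.
Qed.

Lemma span_sub (S I : R -> Prop) f :
  is_ideal I -> (forall g, S g -> I g) -> ideal_span S f -> I f.
Proof.
by move=> HI SI [s [sS ->]]; apply: ideal_sum_in => // p /sS /SI; apply: idealMl.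
Qed.

(** The ideal I + (f). Sequences are adjoined one element at a time, so that each
    step involves a single multiplication by f. *)
Definition adjoin1 I f : R -> Prop := fun g => exists h, I (g - h * f).

Lemma adjoin1_is_ideal I f : is_ideal I -> is_ideal (adjoin1 I f).
Proof.
move=> HI; split=> [|a b [h Ih] [k Ik]|a b [h Ih]].
- by exists 0; rewrite mul0r subr0; apply: ideal0.
- exists (h + k); rewrite (_ : _ - _ = (a - h * f) + (b - k * f)); last by ring.
  exact: idealD.
- exists (a * h); rewrite (_ : _ - _ = a * (b - h * f)); last by ring.
  exact: idealMl.
Qed.

Lemma adjoin_is_ideal I s : is_ideal (ideal_adjoin I s).
Proof. exact: span_is_ideal. Qed.

Lemma sub_adjoin I s f : I f -> ideal_adjoin I s f.
Proof. by move=> If; apply: mem_span; left. Qed.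

Lemma mem_adjoin I s f : f \in s -> ideal_adjoin I s f.
Proof. by move=> fs; apply: mem_span; right. Qed.

Lemma adjoin_sub I L s f : is_ideal L ->
  (forall g, I g -> L g) -> (forall g, g \in s -> L g) -> ideal_adjoin I s f -> L f.
Proof. by move=> HL IL sL; apply: span_sub => // g [/IL|/sL]. Qed.

Lemma adjoin_nil I : is_ideal I -> ideal_adjoin I [::] = I.
Proof.
move=> HI; apply: functional_extensionality => f; apply: propositional_extensionality.
by split=> [|/sub_adjoin]; [apply: adjoin_sub | apply].
Qed.

Lemma adjoin_rcons I s f : ideal_adjoin I (rcons s f) = adjoin1 (ideal_adjoin I s) f.
Proof.
apply: functional_extensionality => g; apply: propositional_extensionality; split.
  apply: adjoin_sub => [|h Ih|h].
  - exact/adjoin1_is_ideal/adjoin_is_ideal.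
  - by exists 0; rewrite mul0r subr0; apply: sub_adjoin.
  - rewrite mem_rcons inE => /orP [/eqP ->|hs].
      by exists 1; rewrite mul1r subrr; apply: ideal0; apply: adjoin_is_ideal.
    by exists 0; rewrite mul0r subr0; apply: mem_adjoin.
have HI := adjoin_is_ideal I (rcons s f).
case=> h Ih; rewrite -(subrK (h * f) g); apply: idealD => //; last first.
  by apply: idealMl => //; apply: mem_adjoin; rewrite mem_rcons mem_head.
move: Ih; apply: adjoin_sub => // k; first exact: sub_adjoin.
by move=> ks; apply: mem_adjoin; rewrite mem_rcons inE ks orbT.
Qed.

(** Each term of the binomial expansion is divisible by a^p or by b^q. *)
Lemma ideal_pow_sum I a b g p q : is_ideal I ->
  I (a ^+ p * g) -> I (b ^+ q * g) -> I ((a + b) ^+ (p + q) * g).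
Proof.
move=> HI Ia Ib; rewrite exprDn mulr_suml; apply: ideal_sum => // -[i /= _] _.
rewrite mulrnAl -mulr_natl; apply: idealMl => //.
have [le_ip|lt_pi] := leqP i q.
  rewrite (_ : (p + q - i)%N = (q - i) + p)%N; last by rewrite addnC addnBAC.
  rewrite exprD (_ : _ * g = a ^+ (q - i) * b ^+ i * (a ^+ p * g)); last by ring.
  exact: idealMl.
rewrite -(subnK (ltnW lt_pi)) exprD.
set x := a ^+ _; rewrite (_ : _ * g = x * b ^+ (i - q) * (b ^+ q * g)); last by ring.
exact: idealMl.
Qed.

Definition saturation I f : R -> Prop := fun g => exists k, I (f ^+ k * g).

Lemma saturation_is_ideal I f : is_ideal I -> is_ideal (saturation I f).
Proof.
move=> HI; split=> [|a b [k Ik] [l Il]|a b [k Ik]].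
- by exists 0%N; rewrite mulr0; apply: ideal0.
- exists (k + l)%N; rewrite mulrDr; apply: idealD => //.
    by rewrite exprD mulrAC mulrC; apply: idealMl.
  by rewrite exprD -mulrA; apply: idealMl.
- by exists k; rewrite mulrCA; apply: idealMl.
Qed.

(** The radical of the colon ideal I : g. *)
Definition nilpotent_on I g : R -> Prop := fun f => saturation I f g.

Lemma nilpotent_on_is_ideal I g : is_ideal I -> is_ideal (nilpotent_on I g).
Proof.
move=> HI; split=> [|a b [k Ik] [l Il]|a b [k Ik]].
- by exists 1%N; rewrite expr1 mul0r; apply: ideal0.
- by exists (k + l)%N; apply: ideal_pow_sum.
- by exists k; rewrite exprMn -mulrA; apply: idealMl.
Qed.

Lemma nilpotent_onX I g f k : nilpotent_on I g (f ^+ k) -> nilpotent_on I g f.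
Proof. by case=> l; rewrite -exprM; exists (k * l)%N. Qed.

End IdealTheory.

(** * Koszul homology and nonzerodivisors *)

Section Koszul.
Variables (R : comNzRingType) (n : nat) (y : 'I_n -> R).
Implicit Types (phi psi : {set 'I_n} -> R) (C : {set 'I_n}) (I : R -> Prop) (f g : R).

(** A function phi on subsets stands for the element sum of phi C e_C of the
    Koszul complex on y, where e_C is the exterior product of the e_i, i in C, in
    increasing order; hence this sign. *)
Definition ksign (i : 'I_n) C : R := (-1) ^+ #|[set j in C | (j < i)%N]|.

Definition boundary phi C : R :=
  \sum_(i | i \notin C) ksign i C * y i * phi (i |: C).

Definition supported (j : nat) phi := forall C, #|C| != j -> phi C = 0.

(** Vanishing of the j-th Koszul homology of R/I. Chains over R/I are represented
    by chains over R. *)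
Definition acyclic I (j : nat) :=
  forall phi, supported j phi -> (forall C, I (boundary phi C)) ->
  exists2 psi, supported j.+1 psi & forall C, I (phi C - boundary psi C).

Definition acyclic_from I (j0 : nat) := forall j, (j0 <= j)%N -> acyclic I j.

Lemma boundaryZ g phi C : boundary (fun C => g * phi C) C = g * boundary phi C.
Proof. by rewrite mulr_sumr; apply: eq_bigr => i _; rewrite mulrCA. Qed.

Lemma boundaryB phi psi C :
  boundary (fun C => phi C - psi C) C = boundary phi C - boundary psi C.
Proof. by rewrite -sumrB /=; apply: eq_bigr => i _; rewrite mulrBr. Qed.

Lemma boundary_sum (T : Type) (r : seq T) (F : T -> {set 'I_n} -> R) C :
  boundary (fun C => \sum_(x <- r) F x C) C = \sum_(x <- r) boundary (F x) C.
Proof. by rewrite exchange_big; apply: eq_bigr => i _; rewrite mulr_sumr. Qed.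

Lemma boundary_in I phi C : is_ideal I ->
  (forall C, I (phi C)) -> I (boundary phi C).
Proof. by move=> HI Iphi; apply: ideal_sum => // i _; apply: idealMl. Qed.

Lemma supported_boundary j psi : supported j.+1 psi -> supported j (boundary psi).
Proof.
move=> spsi C sC; rewrite /boundary big1 // => i iC.
by rewrite spsi ?mulr0 // cardsU1 iC.
Qed.

Lemma ksign_sqr i C : ksign i C * ksign i C = 1.
Proof. by rewrite -expr2 sqrr_sign. Qed.

Lemma ksign_below (i j : 'I_n) C : (j <= i)%N -> ksign j (i |: C) = ksign j C.
Proof.
move=> ji; rewrite /ksign; congr (_ ^+ #|pred_of_set _|); apply/setP => k.
by rewrite !inE; case: eqP => //= ->; rewrite ltnNge ji andbF.
Qed.

Lemma ksign_above (i j : 'I_n) C : (i < j)%N -> i \notin C -> ksign j (i |: C) = - ksign j C.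
Proof.
move=> ij iC; rewrite /ksign -[RHS]mulN1r -exprS.
rewrite (_ : [set k in i |: C | (k < j)%N] = i |: [set k in C | (k < j)%N]).
  by rewrite cardsU1 !inE (negPf iC).
by apply/setP => k; rewrite !inE; case: eqP => //= ->; rewrite ij.
Qed.

Lemma ksign_swap (i j : 'I_n) C : i \notin C -> j \notin C -> i != j ->
  ksign i C * ksign j (i |: C) = - (ksign j C * ksign i (j |: C)).
Proof.
move=> iC jC; rewrite neq_ltn => /orP [ij|ji].
  by rewrite ksign_above // ksign_below 1?ltnW // mulrN mulrC.
by rewrite ksign_below 1?ltnW // ksign_above // mulrN opprK mulrC.
Qed.

Lemma boundary_boundary phi C : boundary (boundary phi) C = 0.
Proof.
pose F i j := ksign i C * ksign j (i |: C) * (y i * y j * phi (j |: (i |: C))).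
pose P i j := [&& i \notin C, j \notin C & i != j].
have -> : boundary (boundary phi) C = \sum_i \sum_(j | P i j) F i j.
  rewrite /boundary [LHS]big_mkcond; apply: eq_bigr => i _; case: ifP => iC; last first.
    by rewrite big1 // => j /and3P []; rewrite iC.
  rewrite mulr_sumr; apply: eq_big => [j|j _].
    by rewrite /P iC !inE negb_or andbC eq_sym.
  by rewrite /F; ring.
pose L := \sum_i \sum_(j | P i j && (i < j)%N) F i j.
have -> : \sum_i \sum_(j | P i j) F i j = L + \sum_i \sum_(j | P i j && ~~ (i < j)%N) F i j.
  by rewrite -big_split /=; apply: eq_bigr => i _; rewrite (bigID (fun j : 'I_n => (i < j)%N)).
rewrite -[X in _ + X]opprK -sumrN; apply/eqP; rewrite subr_eq0; apply/eqP.
under [RHS]eq_bigr do rewrite -sumrN.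
rewrite /L (exchange_big_dep xpredT) //=; apply: eq_bigr => j _.
apply: eq_big => [i|i /andP [/and3P [iC jC ij] _]].
  rewrite /P eq_sym -leqNgt ltn_neqAle; case: (i =P j) => [->|/eqP ne].
    by rewrite eqxx !andbF.
  have -> : (nat_of_ord i != j) by [].
  by case: (i \notin C); case: (j \notin C).
by rewrite /F ksign_swap // setUCA mulNr (mulrC (y i)).
Qed.

(** Exterior multiplication by e_i. *)
Definition cone (i : 'I_n) phi C : R :=
  if i \in C then ksign i C * phi (C :\ i) else 0.

Lemma supported_cone i j phi : supported j phi -> supported j.+1 (cone i phi).
Proof.
move=> sphi C sC; rewrite /cone; case: ifP => // iC.
by rewrite sphi ?mulr0 //; move: sC; rewrite (cardsD1 i) iC.
Qed.

(** This shows that y i acts as zero on Koszul homology. *)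
Lemma cone_homotopy i phi C :
  y i * phi C = boundary (cone i phi) C + cone i (boundary phi) C.
Proof.
rewrite {2}/cone; case: ifP => iC; last first.
  rewrite addr0 /boundary (bigD1 i) ?iC //= big1 ?addr0; last first.
    move=> j /andP [jC ji]; rewrite /cone !inE iC orbF eq_sym (negPf ji) mulr0.
    by [].
  rewrite /cone setU11 setU1K ?iC // ksign_below //.
  by rewrite mulrACA mulrA -!mulrA (mulrA (ksign _ _)) ksign_sqr mul1r.
pose D := C :\ i.
have iD : i \notin D by rewrite !inE eqxx.
have CE : C = i |: D by rewrite setD1K.
rewrite /boundary [X in _ + _ * X](bigD1 i) //= -CE mulrDr mulrA mulrA.
have iCD : ksign i C = ksign i D by rewrite CE ksign_below.
rewrite -/D iCD ksign_sqr mul1r addrCA -[LHS]addr0; congr (_ + _).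
apply/esym.
rewrite mulr_sumr (eq_bigl (fun j => (j \notin D) && (j != i))); last first.
  by move=> j; rewrite !inE; case: eqP => [->|_]; rewrite ?iC //= andbT.
rewrite -big_split /= big1 // => j /andP [jD ji].
rewrite /cone inE iC orbT.
have -> : (j |: C) :\ i = j |: D.
  by rewrite CE setUCA setU1K // !inE eq_sym negb_or ji eqxx.
rewrite {1 2}CE.
have sw := ksign_swap iD jD; rewrite eq_sym ji in sw.
have {}sw := sw isT.
have -> : ksign i (j |: (i |: D)) = ksign i (j |: D).
  by rewrite setUCA ksign_below.
have e : ksign j (i |: D) * ksign i (j |: D) = - (ksign i D * ksign j D).
  rewrite -[LHS]mul1r -(ksign_sqr i D) -mulrA (mulrA (ksign i D) (ksign j _)) sw.
  by rewrite mulNr mulrN -mulrA ksign_sqr mulr1.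
rewrite (_ : _ + _ = (ksign j (i |: D) * ksign i (j |: D) + ksign i D * ksign j D)
  * (y j * phi (j |: D))); last by ring.
by rewrite e addNr mul0r.
Qed.

Section Acyclicity.
Variables (I : R -> Prop) (f : R).
Hypothesis HI : is_ideal I.
Hypothesis f_reg : forall g, I (f * g) -> I g.

(** Exactness of H_(j+1)(R/I) -> H_(j+1)(R/(I + (f))) -> H_j(R/I) at the middle
    term, chased on representatives. *)
Lemma acyclic_adjoin1 j : acyclic I j -> acyclic I j.+1 -> acyclic (adjoin1 I f) j.+1.
Proof.
move=> acj acj1 phi sphi cphi.
have /fin_all_exists [psi0 psi0P] : forall C, exists h, I (boundary phi C - h * f) by [].
pose psi C := if #|C| == j then psi0 C else 0.
have spsi : supported j psi by move=> C /negPf Cj; rewrite /psi Cj.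
have psiP C : I (boundary phi C - f * psi C).
  rewrite /psi; case: eqP => [_|/eqP Cj]; first by rewrite mulrC.
  by rewrite (supported_boundary sphi) // mulr0 subr0; apply: ideal0.
(* f times the boundary of psi is in I, because two boundaries compose to 0. *)
have [|chi schi chiP] := acj psi spsi.
  move=> C; apply: f_reg.
  have -> : f * boundary psi C = - boundary (fun C => boundary phi C - f * psi C) C.
    by rewrite boundaryB boundary_boundary sub0r opprK boundaryZ.
  by apply: idealN => //; apply: boundary_in.
have [||om som omP] := acj1 (fun C => phi C - f * chi C).
- by move=> C Cj; rewrite sphi // schi // mulr0 subrr.
- move=> C; rewrite boundaryB boundaryZ.
  rewrite (_ : _ - _ = (boundary phi C - f * psi C) + f * (psi C - boundary chi C)); last by ring.
  by apply: idealD => //; apply: idealMl.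
exists om => // C; exists (chi C).
by have := omP C; rewrite [f * _]mulrC addrAC.
Qed.

(** By the long exact sequence, H_(j+1)(R/(I + (f))) = 0 makes multiplication by f
    injective on H_j(R/I). On the other hand f^k acts as zero there, since every
    y i does. *)
Lemma acyclic_of_adjoin1 j k (z : 'I_n -> R) : f ^+ k = \sum_i z i * y i ->
  acyclic (adjoin1 I f) j.+1 -> acyclic I j.
Proof.
move=> fk acj phi sphi cphi.
pose bounds g := exists2 psi, supported j.+1 psi & forall C, I (g * phi C - boundary psi C).
have boundsf : bounds (f ^+ k).
  exists (fun C => \sum_i z i * cone i phi C) => [C Cj|C].
    by apply: big1 => i _; rewrite (supported_cone _ sphi) ?mulr0.
  rewrite boundary_sum fk mulr_suml -sumrB; apply: ideal_sum => // i _.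
  rewrite boundaryZ -mulrA cone_homotopy mulrDr addrAC subrr add0r.
  apply: idealMl => //; rewrite /cone; case: ifP => _; last exact: ideal0.
  exact: idealMl.
suff descent m : bounds (f ^+ m) -> bounds 1.
  by have [psi spsi psiP] := descent k boundsf; exists psi => // C; rewrite -[phi C]mul1r.
elim: m => [|m IHm]; first by rewrite expr0.
case=> psi spsi psiP; apply: IHm.
(* psi bounds f ^+ m.+1 * phi, hence is a cycle modulo I + (f). *)
have [C|chi schi chiP] := acj psi spsi.
  exists (f ^+ m * phi C); rewrite -opprB (_ : _ - _ = f ^+ m.+1 * phi C - boundary psi C).
    exact: idealN.
  by rewrite exprSr mulrAC.
have /fin_all_exists [om0 om0P] : forall C, exists h, I (psi C - boundary chi C - h * f) by [].
pose om C := if #|C| == j.+1 then om0 C else 0.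
have omP C : I (psi C - boundary chi C - f * om C).
  rewrite /om; case: eqP => [_|/eqP Cj]; first by rewrite mulrC.
  by rewrite (supported_boundary schi) // spsi // mulr0 !subr0; apply: ideal0.
exists om => [C /negPf Cj|C]; first by rewrite /om Cj.
apply: f_reg.
rewrite (_ : _ * _ = (f ^+ m.+1 * phi C - boundary psi C)
    + boundary (fun C => psi C - boundary chi C - f * om C) C).
  by apply: idealD => //; apply: boundary_in.
by rewrite !boundaryB boundary_boundary boundaryZ exprS; ring.
Qed.

End Acyclicity.

(** Dividing out a nonzerodivisor raises the top degree of nonvanishing Koszul
    homology by exactly one. *)
Lemma acyclic_from_adjoin1 I f k (z : 'I_n -> R) j : is_ideal I ->
  (forall g, I (f * g) -> I g) -> f ^+ k = \sum_i z i * y i ->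
  acyclic_from I j <-> acyclic_from (adjoin1 I f) j.+1.
Proof.
move=> HI f_reg fk; split=> acI i ji; last first.
  by apply: (acyclic_of_adjoin1 HI f_reg fk); apply: acI.
case: i ji => // i; rewrite ltnS => ji.
by apply: acyclic_adjoin1 => //; apply: acI; rewrite ?leqW.
Qed.

Lemma acyclic_from_large I : is_ideal I -> acyclic_from I n.+1.
Proof.
move=> HI j nj phi sphi _; exists (fun=> 0) => // C.
rewrite sphi ?sub0r; last first.
  by rewrite neq_ltn (leq_trans _ nj) // ltnS -[X in (_ <= X)%N]card_ord max_card.
by apply: idealN => //; apply: boundary_in => // C'; apply: ideal0.
Qed.

(** H_n(R/I) is the submodule of R/I annihilated by all y i. *)
Lemma acyclic_top I g : is_ideal I -> acyclic I n ->
  (forall i, I (y i * g)) -> I g.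
Proof.
move=> HI acI yg.
have cardT C : #|C| != n -> C != setT.
  by apply: contraNneq => ->; rewrite cardsT card_ord.
have [C /cardT /negPf -> //|C|psi spsi psiP] :=
    acI (fun C => if C == setT then g else 0).
  apply: ideal_sum => // i _; case: ifP => _; rewrite ?mulr0 -?mulrA.
    exact: idealMl.
  exact: ideal0.
have := psiP setT; rewrite eqxx /boundary big1 ?subr0 // => i _.
by rewrite spsi ?mulr0 // neq_ltn (leq_ltn_trans (max_card _)) ?card_ord.
Qed.

(** H_0(R/I) is R/(I + (y)). *)
Lemma not_acyclic0 I (M : R -> Prop) : is_ideal M -> (forall g, I g -> M g) ->
  (forall i, M (y i)) -> acyclic I 0 -> I 0 -> M 1.
Proof.
move=> HM IM yM acI I0.
have [C|C|psi _ psiP] := acI (fun C => (C == set0)%:R).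
- by rewrite -cards_eq0 => /negPf ->.
- rewrite /boundary big1 // => i _.
  rewrite (_ : (i |: C == set0) = false) ?mulr0 //.
  by apply/negbTE/set0Pn; exists i; rewrite setU11.
have := psiP set0; rewrite eqxx => /IM M1.
rewrite -(subrK (boundary psi set0) 1); apply: idealD => //.
by apply: ideal_sum => // i _; apply: (ideal_mulr _ HM); apply: idealMl.
Qed.

End Koszul.

(** * Noetherianity and homogeneous avoidance *)

Lemma functional_choice (A B : Type) (P : A -> B -> Prop) :
  (forall x, exists y, P x y) -> exists h, forall x, P x (h x).
Proof.
move=> ex; exists (fun x => proj1_sig (constructive_indefinite_description _ (ex x))) => x.
exact: proj2_sig.
Qed.

Section Dickson.
Local Open Scope nat_scope.

Lemma exists_tail_min (u : nat -> nat) i : exists2 j, i <= j & forall k, i <= k -> u j <= u k.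
Proof.
suff main m j : i <= j -> u j < m -> exists2 j, i <= j & forall k, i <= k -> u j <= u k.
  exact: main (leqnn i) (ltnSn (u i)).
elim: m j => // m IHm j ij um.
have [[k [ik ukj]]|none] := classic (exists k, i <= k /\ u k < u j).
  by apply: (IHm k) => //; apply: leq_trans ukj _.
exists j => // k ik; rewrite leqNgt; apply/negP => ukj; apply: none.
by exists k.
Qed.

(** Each index minimises u over all indices beyond the previous one. *)
Lemma nondecreasing_subsequence (u : nat -> nat) :
  exists s : nat -> nat, forall k, s k < s k.+1 /\ u (s k) <= u (s k.+1).
Proof.
have /functional_choice [h hP] : forall i, exists j, i <= j /\ forall k, i <= k -> u j <= u k.
  by move=> i; have [j] := exists_tail_min u i; exists j.
pose s := fix s k := if k is k'.+1 then h (s k').+1 else h 0.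
have s_inc k : s k < s k.+1 by exact: (proj1 (hP (s k).+1)).
exists s => k; split=> //; case: k => [|k]; first exact: (proj2 (hP 0)).
by apply: (proj2 (hP (s k).+1)); apply: ltn_trans (s_inc k.+1).
Qed.

(** Pass to a subsequence on which one more coordinate is nondecreasing, until all
    coordinates are. *)
Lemma dickson n (m : nat -> 'X_{1..n}) : exists i j, i < j /\ (m i <= m j)%MM.
Proof.
have main (r : seq 'I_n) : exists s : nat -> nat, (forall k, s k < s k.+1) /\
    forall i, i \in r -> forall k, m (s k) i <= m (s k.+1) i.
  elim: r => [|a r [s [s_inc sP]]]; first by exists id.
  have [q qP] := nondecreasing_subsequence (fun k => m (s k) a).
  exists (s \o q); split=> [k|i].
    by apply: (homo_ltn ltn_trans s_inc); case: (qP k).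
  rewrite inE => /orP [/eqP -> k|ir k]; first by case: (qP k).
  have := homo_leq (f := fun k => m (s k) i) (r := leq) leqnn leq_trans (sP i ir).
  by apply; apply: ltnW; case: (qP k).
have [s [s_inc sP]] := main (enum 'I_n).
exists (s 0), (s 1); split=> //; apply/mnm_lepP => i; apply: sP.
by rewrite mem_enum.
Qed.

End Dickson.

Section Noetherian.
Variables (K : fieldType) (n : nat).
Local Notation R := {mpoly K[n]}.

(** Cancel the leading term of f against elements of I as long as possible. This
    ends, since monomials are well-ordered, and not at 0, since f is not in I. *)
Lemma exists_new_lead (I I' : R -> Prop) (f : R) : is_ideal I -> is_ideal I' ->
  (forall g, I g -> I' g) -> I' f -> ~ I f ->
  exists p, [/\ I' p, p != 0 & forall h, I h -> h != 0 -> mlead h != mlead p].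
Proof.
move=> HI HI' II'; move: {2}(mlead f) (erefl (mlead f)) => m.
elim/(@ltmwf n): m f => m IHm f fm I'f nIf.
have [[h [Ih [h0 hf]]]|none] := classic (exists h, I h /\ h != 0 /\ mlead h = mlead f);
    last first.
  exists f; split=> // [|h Ih h0]; last by apply/eqP => hf; apply: none; exists h.
  by apply: contra_notN nIf => /eqP ->; apply: ideal0.
(* f and h have the same leading monomial; f' is f with its leading term cancelled. *)
pose c := mleadc f / mleadc h.
pose f' := f - c *: h.
have Ich : I (c *: h) by rewrite -mul_mpolyC; apply: idealMl.
have nIf' : ~ I f' by move=> If'; apply: nIf; rewrite -(subrK (c *: h) f); apply: idealD.
have f'0 : f' != 0 by apply: contra_notN nIf' => /eqP ->; apply: ideal0.
apply: (IHm (mlead f') _ f') => //; last by apply: idealB => //; apply: II'.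
rewrite -fm lt_neqAle; apply/andP; split.
  apply: contraNneq f'0 => e; rewrite -mleadc_eq0 e mcoeffB mcoeffZ /c.
  have -> : h@_(mlead f) = mleadc h by rewrite hf.
  by rewrite divfK ?subrr // mleadc_eq0.
apply: le_trans (mleadB_le _ _) _.
by rewrite leUx lexx /= -hf mleadZ_le.
Qed.

(** If every g k enlarged the ideal, each would contribute a leading monomial absent
    from the previous ideal, and by Dickson's lemma one of these monomials would
    divide a later one. *)
Lemma noetherian (L : R -> Prop) (g : nat -> R) : is_ideal L ->
  exists k, ideal_adjoin L (mkseq g k) (g k).
Proof.
move=> HL; apply: NNPP => none.
pose I k := ideal_adjoin L (mkseq g k).
have HI k : is_ideal (I k) by exact: adjoin_is_ideal.
have IS k f : I k f -> I k.+1 f.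
  by rewrite /I mkseqS adjoin_rcons => If; exists 0; rewrite mul0r subr0.
have Imono i j f : (i <= j)%N -> I i f -> I j f.
  by move/subnK <-; elim: (j - i)%N => // d IHd /IHd /IS.
have /functional_choice [p pP] : forall k, exists p,
    [/\ I k.+1 p, p != 0 & forall h, I k h -> h != 0 -> mlead h != mlead p].
  move=> k; apply: (exists_new_lead (HI _) (HI _) (IS k) (f := g k)).
    by apply: mem_adjoin; rewrite mkseqS mem_rcons mem_head.
  by move=> h; apply: none; exists k.
have p0 k : p k != 0 by case: (pP k).
have [i [j [ij mij]]] := dickson (fun k => mlead (p k)).
have [_ _ /(_ ('X_[mlead (p j) - mlead (p i)] * p i))] := pP j.
have X0 m : 'X_[m] != 0 :> R.
  by apply/eqP => /(congr1 (mcoeff m)) /eqP; rewrite mcoeffX eqxx mcoeff0 oner_eq0.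
have Xp : 'X_[mlead (p j) - mlead (p i)] * p i != 0.
  by rewrite mulf_neq0 // ?p0 // X0.
move/(_ _ Xp); rewrite mleadM ?p0 ?X0 // mleadXm submK // eqxx => contra.
by apply/notF/contra; apply: idealMl => //; apply: (Imono _ _ _ ij); case: (pP i).
Qed.

(** A substitute for prime avoidance that works over any field. Let L be the
    largest ideal such that a power of a, and a power of b, multiplies each of
    its elements into I. The forms F k are pairwise coprime up to radical inside
    (a, b): P k is a power of a modulo b and is divisible by all earlier F j,
    while F k is P k plus a power of b. If each F k had a power multiplying some
    g k outside L into L, then g k would not even lie in the ideal generated by
    L and the earlier g j: a power of P k multiplies that ideal into L, so g k
    would be multiplied into L by powers of both P k and F k, hence of both a
    and b, and would lie in L. This contradicts [noetherian]. *)
Lemma saturation_avoidance_pair (I : R -> Prop) (M : R -> Prop) (a b : R) (d : nat) :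
  is_ideal I -> is_ideal M -> (0 < d)%N -> M a -> M b ->
  a \is d.-homog -> b \is d.-homog ->
  exists f e, [/\ (0 < e)%N, M f, f \is e.-homog
    & forall g, saturation I f g -> saturation I a g /\ saturation I b g].
Proof.
move=> HI HM d0 Ma Mb ha hb.
pose L g := saturation I a g /\ saturation I b g.
have HSa := saturation_is_ideal a HI; have HSb := saturation_is_ideal b HI.
have HL : is_ideal L.
  split=> [|g h [ga gb] [ha' hb']|g h [ha' hb']]; split.
  - exact: (ideal0 HSa).
  - exact: (ideal0 HSb).
  - exact: (idealD HSa).
  - exact: (idealD HSb).
  - exact: (idealMl HSa).
  - exact: (idealMl HSb).
have IL g : I g -> L g by move=> Ig; split; exists 0%N; rewrite mul1r.
have Lsat g : nilpotent_on L g a -> nilpotent_on L g b -> L g.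
  move=> [k [[i Ii] _]] [l [_ [j Ij]]]; split; [exists (i + k)%N|exists (j + l)%N];
    by rewrite exprD -mulrA.
pose P := fix P k := if k is k'.+1 then P k' * (P k' + b ^+ (2 ^ k')) else a.
pose F k := P k + b ^+ (2 ^ k).
have hP k : P k \is (d * 2 ^ k)%N.-homog /\ M (P k).
  elim: k => [|k [hk Mk]]; first by rewrite muln1.
  have hF : P k + b ^+ (2 ^ k) \is (d * 2 ^ k)%N.-homog.
    by rewrite dhomogD // dhomogMn.
  split=> /=; last exact: ideal_mulr.
  by rewrite expnS mul2n -addnn mulnDr dhomogM.
have MF k : M (F k).
  apply: idealD => //; first by case: (hP k).
  by rewrite -[(2 ^ k)%N]prednK ?expn_gt0 // exprS; apply: ideal_mulr.
(* P k is congruent to a ^ (2 ^ k) modulo b. *)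
have Pmod k : exists h, P k = a ^+ (2 ^ k) + h * b.
  elim: k => [|k [h hk]]; first by exists 0; rewrite mul0r addr0.
  exists (h * (P k + b ^+ (2 ^ k)) + a ^+ (2 ^ k) * (h + b ^+ (2 ^ k).-1)).
  rewrite /= {1}hk expnS mul2n -addnn exprD {1}hk.
  have -> : b ^+ (2 ^ k) = b ^+ (2 ^ k).-1 * b by rewrite -exprSr prednK // expn_gt0.
  by rewrite hk; ring.
have Pdiv j k : (j < k)%N -> exists h, P k = h * F j.
  elim: k => // k IHk; rewrite ltnS leq_eqVlt => /orP [/eqP ->|/IHk [h hk]].
    by exists (P k).
  by exists (h * F k); rewrite (_ : P k.+1 = P k * F k) // {1}hk mulrAC.
suff [k kP] : exists k, forall g, saturation L (F k) g -> L g.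
  exists (F k), (d * 2 ^ k)%N; split=> //.
  - by rewrite muln_gt0 d0 expn_gt0.
  - by rewrite dhomogD ?dhomogMn //; case: (hP k).
  - by move=> g [l Il]; apply: kP; exists l; apply: IL.
apply: NNPP => none.
have /functional_choice [g gP] : forall k, exists g, saturation L (F k) g /\ ~ L g.
  move=> k; apply: NNPP => nog; apply: none; exists k => g Lg.
  by apply: NNPP => nLg; apply: nog; exists g.
have [k kP] := noetherian g HL.
apply: (proj2 (gP k)).
have HN := nilpotent_on_is_ideal (g k) HL.
(* From here on, the radical of L : g k is shown to contain a and b. *)
have NF : nilpotent_on L (g k) (F k) by case: (gP k).
have NP : nilpotent_on L (g k) (P k).
  suff : saturation L (P k) (g k) by [].
  have HS := saturation_is_ideal (P k) HL.
  apply: (adjoin_sub HS _ _ kP) => [h Lh|h]; first by exists 0%N; rewrite mul1r.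
  case/mapP => j; rewrite mem_iota add0n => /andP [_ jk] ->.
  have [[l Ll] _] := gP j; exists l; have [h' ->] := Pdiv _ _ jk.
  by rewrite exprMn -mulrA; apply: idealMl.
have Nb : nilpotent_on L (g k) b.
  apply: (@nilpotent_onX _ _ _ _ (2 ^ k)).
  by rewrite (_ : _ ^+ _ = F k - P k); [apply: idealB | rewrite /F addrC addKr].
have Na : nilpotent_on L (g k) a.
  apply: (@nilpotent_onX _ _ _ _ (2 ^ k)); have [h hk] := Pmod k.
  rewrite (_ : _ ^+ _ = P k - h * b); last by rewrite hk addrK.
  by apply: (idealB HN NP); apply: (idealMl HN).
exact: (Lsat (g k) Na Nb).
Qed.

(** The generators are merged two at a time; powers make the degrees agree. *)
Lemma saturation_avoidance (I M : R -> Prop) (r : seq R) : is_ideal I -> is_ideal M ->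
  r != [::] -> (forall a, a \in r -> M a /\ a \is 1.-homog) ->
  exists f e, [/\ (0 < e)%N, M f, f \is e.-homog
    & forall g, saturation I f g -> forall a, a \in r -> saturation I a g].
Proof.
move=> HI HM; case: r => // a r _; elim: r a => [|b r IHr] a rP.
  exists a, 1%N; have [Ma ha] := rP a (mem_head _ _); split=> // g Ig b.
  by rewrite inE => /eqP ->.
have [|f [e [e0 Mf hf fP]]] := IHr b.
  by move=> c cr; apply: rP; rewrite inE cr orbT.
have [Ma ha] := rP a (mem_head _ _).
have Mae : M (a ^+ e) by rewrite -(prednK e0) exprS; apply: ideal_mulr.
have hae : a ^+ e \is e.-homog by have := dhomogMn e ha; rewrite mul1n.
have [f' [e' [e'0 Mf' hf' f'P]]] := saturation_avoidance_pair HI HM e0 Mae Mf hae hf.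
exists f', e'; split=> // g /f'P [ga gf] c; rewrite inE => /orP [/eqP ->|]; last exact: fP.
exact: nilpotent_onX ga.
Qed.

End Noetherian.

(** * Powers of the cover ideal and multidegrees *)

Section Symbolic.
Variables (K : fieldType) (n : nat) (H : hypergraph n).
Local Notation R := {mpoly K[n]}.

Definition heavy (t : nat) (m : 'X_{1..n}) : bool :=
  [forall E in edges H, (t <= weight m E)%N].

(** The intersection of the t-th powers of the primes (x_i | i in E), described by
    its monomials. *)
Definition symbolic_power (t : nat) (f : R) : Prop :=
  forall m, f@_m != 0 -> heavy t m.

Lemma weightD (m m' : 'X_{1..n}) E : weight (m + m')%MM E = (weight m E + weight m' E)%N.
Proof. by rewrite /weight -big_split; apply: eq_bigr => i _; rewrite mnmDE. Qed.

Lemma heavyD t t' (m m' : 'X_{1..n}) : heavy t m -> heavy t' m' -> heavy (t + t') (m + m')%MM.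
Proof.
move=> /forall_inP hm /forall_inP hm'; apply/forall_inP => E EH.
by rewrite weightD leq_add ?hm ?hm'.
Qed.

Lemma heavy0 m : heavy 0 m.
Proof. by apply/forall_inP. Qed.

Lemma symbolic_powerM t t' f g :
  symbolic_power t f -> symbolic_power t' g -> symbolic_power (t + t') (f * g).
Proof.
move=> hf hg m; rewrite -mcoeff_msupp => /msuppM_le /allpairsP [[m1 m2] /= [m1f m2g ->]].
by apply: heavyD; [apply: hf|apply: hg]; rewrite -mcoeff_msupp.
Qed.

Lemma symbolic_power_is_ideal t : is_ideal (symbolic_power t).
Proof.
split=> [m|f g hf hg m|f g hg].
- by rewrite mcoeff0 eqxx.
- rewrite mcoeffD; have [->|f0 _] := eqVneq f@_m 0; last exact: hf.
  by rewrite add0r; apply: hg.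
- by rewrite -[t]add0n; apply: symbolic_powerM => // m _; apply: heavy0.
Qed.

Lemma symbolic_power_prod t (s : seq R) : (forall g, g \in s -> symbolic_power t g) ->
  symbolic_power (t * size s) (\prod_(g <- s) g).
Proof.
elim: s => [|g s IHs] sP; first by rewrite muln0 => m _; apply: heavy0.
rewrite big_cons /= mulnS; apply: symbolic_powerM; first by apply: sP; apply: mem_head.
by apply: IHs => h hs; apply: sP; rewrite inE hs orbT.
Qed.

Lemma mpolyX_big (T : Type) (r : seq T) (P : pred T) (F : T -> 'X_{1..n}) :
  \prod_(x <- r | P x) 'X_[F x] = 'X_[\sum_(x <- r | P x) F x]%MM :> R.
Proof. exact/esym/(big_morph _ (@mpolyXD _ _) (mpolyX0 _ _)). Qed.

Definition mnm_of_set (S : {set 'I_n}) : 'X_{1..n} := [multinom (i \in S : nat) | i < n].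

Lemma mpolyX_mnm_of_set (S : {set 'I_n}) : \prod_(i in S) 'X_i = 'X_[mnm_of_set S] :> R.
Proof.
rewrite mpolyX_big; congr 'X_[_]; apply/mnmP => j; rewrite mnm_sumE mnmE big_mkcond /=.
rewrite (bigD1 j) //= mnm1E eqxx big1 ?addn0; first by case: (j \in S).
by move=> i /negPf ij; rewrite mnm1E ij; case: ifP.
Qed.

Lemma cover_ideal_symbolic f : cover_ideal K H f -> symbolic_power 1 f.
Proof.
apply: span_sub => [|_ [tau /minsetP [/forall_inP tauP _] ->]].
  exact: symbolic_power_is_ideal.
rewrite mpolyX_mnm_of_set => m; rewrite mcoeffX; case: (_ =P m) => [<- _|]; last by rewrite eqxx.
apply/forall_inP => E /tauP /set0Pn [i]; rewrite inE => /andP [itau iE].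
by apply: (weight_gt0 iE); rewrite mnmE itau.
Qed.

(** Colour the exponent vector m of a monomial that has weight at least t on each
    edge with t colours. Every colour meets every edge, so its support contains
    a minimal cover, and the product of these t covers divides the monomial. *)
Lemma cover_pow_symbolic (balH : balanced H) t : (0 < t)%N ->
  ideal_pow (cover_ideal K H) t = symbolic_power t.
Proof.
move=> t0; apply: functional_extensionality => f; apply: propositional_extensionality.
split.
  apply: span_sub => [|_ [s [sP ->]]]; first exact: symbolic_power_is_ideal.
  have := @symbolic_power_prod 1 s; rewrite mul1n size_tuple; apply.
  by move=> g /sP /cover_ideal_symbolic.
have HJ : is_ideal (ideal_pow (cover_ideal K H) t) by exact: span_is_ideal.
move=> fP; rewrite [f]mpolyE; apply: ideal_sum_in => // m; rewrite mcoeff_msupp => /fP hm.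
rewrite -mul_mpolyC; apply: idealMl => //.
have [u [um uP]] := balanced_colouring balH m t0.
have /fin_all_exists [tau tauP] : forall c : 'I_t, exists tau,
    minset (vertex_cover H) tau /\ tau \subset [set i | (0 < u c i)%N].
  move=> c; have [|tau ? ?] := @minset_exists _ (vertex_cover H) [set i | (0 < u c i)%N].
    apply/forall_inP => E EH; have /forall_inP /(_ E EH) /(proj1 (uP E EH)) /(_ c) := hm.
    rewrite /weight lt0n => w0; apply/set0Pn; apply/existsP; apply: contraNT w0.
    rewrite negb_exists => /forallP h; rewrite big1 // => i iE; apply/eqP.
    by have := h i; rewrite !inE iE andbT -eqn0Ngt.
  by exists tau.
have le_m : (\sum_c mnm_of_set (tau c) <= m)%MM.
  apply/mnm_lepP => i; rewrite mnm_sumE -um; apply: leq_sum => c _; rewrite mnmE.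
  by case: (boolP (i \in _)) => // /(subsetP (proj2 (tauP c))); rewrite inE.
rewrite -(submK le_m) mpolyXD; apply: idealMl => //; apply: mem_span.
exists [tuple 'X_[mnm_of_set (tau c)] | c < t]; split.
  move=> g /mapP [c _ ->]; apply: mem_span; exists (tau c); first by case: (tauP c).
  by rewrite mpolyX_mnm_of_set.
by rewrite big_tuple -mpolyX_big; apply: eq_bigr => c _; rewrite tnth_mktuple.
Qed.


Section Multidegree.
Variable N : nat.
Implicit Types C : {set 'I_n}.

(** The multidegree of e_C in the Koszul complex on the N-th powers of the
    variables. *)
Definition shift (C : {set 'I_n}) : 'X_{1..n} := [multinom (N * (i \in C))%N | i < n].

Lemma shiftE C i : shift C i = (N * (i \in C))%N.
Proof. exact: mnmE. Qed.

Lemma shiftP (A : 'X_{1..n}) C :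
  reflect (forall i, i \in C -> (N <= A i)%N) (shift C <= A)%MM.
Proof.
apply: (iffP mnm_lepP) => h i; have := h i; rewrite mnmE.
  by move=> + iC; rewrite iC muln1.
by case: (i \in C) => [/(_ isT)|_]; rewrite ?muln0 ?muln1.
Qed.

Lemma shiftU i C : i \notin C -> shift (i |: C) = (shift C + U_(i) *+ N)%MM.
Proof.
move=> iC; apply/mnmP => j; rewrite mnmDE !mnmE mulmnE mnm1E !inE (eq_sym i).
by case: eqP => [->|_]; rewrite ?(negPf iC) ?orbF ?mul0n ?muln0 ?addn0 // mul1n muln1.
Qed.

Definition var_pow (i : 'I_n) : R := 'X_i ^+ N.

(** The component of a chain in multidegree A is a family of scalars, as phi C then
    can only involve the monomial of exponent A - shift C. *)
Definition coefs (A : 'X_{1..n}) (phi : {set 'I_n} -> R) (C : {set 'I_n}) : K :=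
  if (shift C <= A)%MM then (phi C)@_(A - shift C) else 0.

Definition homogeneous_chain (A : 'X_{1..n}) (c : {set 'I_n} -> K) (C : {set 'I_n}) : R :=
  c C *: 'X_[A - shift C].

(** Subtraction of exponents is truncated, so the families of scalars that come
    from multidegree A have to be singled out. *)
Definition admissible A (c : {set 'I_n} -> K) := forall C, ~~ (shift C <= A)%MM -> c C = 0.

Lemma admissible_coefs A phi : admissible A (coefs A phi).
Proof. by move=> C /negPf nCA; rewrite /coefs nCA. Qed.

Lemma coefs_homogeneous_chain A c : admissible A c -> forall C,
  coefs A (homogeneous_chain A c) C = c C.
Proof.
move=> adm C; rewrite /coefs; case: ifP => [_|/negbT/adm ->] //.
by rewrite mcoeffZ mcoeffX eqxx mulr1.
Qed.

Lemma ksign_scale i C (p : R) : ksign R i C * p = ksign K i C *: p.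
Proof. by rewrite /ksign -signr_odd mulr_sign -signr_odd scaler_sign. Qed.

Lemma mcoeffMXn (p : R) k m :
  (p * 'X_[k])@_m = if (k <= m)%MM then p@_(m - k) else 0.
Proof.
case: ifP => [km|/negbT km]; first by rewrite -{1}(submK km) addmC mcoeffMX.
apply: memN_msupp_eq0; rewrite (perm_mem (msuppMX _ _)); apply: contra km.
by case/mapP => m' _ ->; apply: lem_addr.
Qed.

Definition scalar_boundary (c : {set 'I_n} -> K) C : K :=
  boundary (fun=> 1) c C.

Lemma coefs_boundary A phi C :
  coefs A (boundary var_pow phi) C = scalar_boundary (coefs A phi) C.
Proof.
rewrite /coefs /scalar_boundary /boundary; case: ifP => [CA|/negbT nCA]; last first.
  rewrite big1 // => i iC; case: ifP => [|_]; last by rewrite mulr0.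
  by rewrite shiftU // => /(lepm_trans (lem_addr _ _)); rewrite (negPf nCA).
rewrite raddf_sum; apply: eq_bigr => i iC /=.
rewrite -mulrA ksign_scale mcoeffZ mulr1; congr (_ * _).
rewrite /var_pow mulrC mpolyXn mcoeffMXn shiftU //.
have -> : (U_(i) *+ N <= A - shift C)%MM = (shift C + U_(i) *+ N <= A)%MM.
  apply/mnm_lepP/mnm_lepP => h j; have := h j; have := mnm_lepP CA j;
    rewrite mnmBE mnmDE; lia.
by case: ifP => // _; rewrite submDA.
Qed.

Lemma boundary_homogeneous_chain A c : admissible A c -> forall C,
  boundary var_pow (homogeneous_chain A c) C = homogeneous_chain A (scalar_boundary c) C.
Proof.
move=> adm C; rewrite /boundary /homogeneous_chain /scalar_boundary /boundary scaler_suml.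
apply: eq_bigr => i iC; rewrite -mulrA ksign_scale mulr1 -scalerA; congr (_ *: _).
have [CA|/adm ->] := boolP (shift (i |: C) <= A)%MM; last by rewrite !scale0r mulr0.
rewrite -scalerAr /var_pow mpolyXn -mpolyXD; congr (_ *: 'X_[_]).
rewrite shiftU //; rewrite shiftU // in CA; apply/mnmP => j; have := mnm_lepP CA j.
by rewrite !(mnmDE, mnmBE); lia.
Qed.

Lemma coefs_sum (phi : {set 'I_n} -> R) (r : seq 'X_{1..n}) : uniq r ->
  (forall C m, (phi C)@_m != 0 -> (m + shift C)%MM \in r) ->
  forall C, phi C = \sum_(A <- r) homogeneous_chain A (coefs A phi) C.
Proof.
move=> ur rP C; apply/mpolyP => m; rewrite raddf_sum /=.
have term A : (homogeneous_chain A (coefs A phi) C)@_m =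
    if A == (m + shift C)%MM then (phi C)@_m else 0.
  rewrite /homogeneous_chain /coefs mcoeffZ mcoeffX; case: ifP => [CA|nCA]; last first.
    rewrite mul0r; case: eqP => // AE; by rewrite AE lem_addl in nCA.
  have -> : ((A - shift C)%MM == m) = (A == (m + shift C)%MM).
    by apply/eqP/eqP => [<-|->]; rewrite ?submK ?addmK.
  by case: eqP => [->|_]; rewrite ?mulr0 // addmK mulr1.
under eq_bigr do rewrite term.
rewrite -big_mkcond; have [inr|] := boolP ((m + shift C)%MM \in r).
  by rewrite -big_filter filter_pred1_uniq // big_seq1.
move=> nr; rewrite (_ : (phi C)@_m = 0) ?big1 //.
by apply/eqP; apply: contraNT nr; apply: rP.
Qed.

Lemma exists_multidegrees (phi : {set 'I_n} -> R) : exists2 r : seq 'X_{1..n}, uniq r &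
  (forall C m, (phi C)@_m != 0 -> (m + shift C)%MM \in r).
Proof.
exists (undup (flatten [seq [seq (m + shift C)%MM | m <- msupp (phi C)] | C : {set 'I_n}])).
  exact: undup_uniq.
move=> C m cm; rewrite mem_undup; apply/flattenP.
exists [seq (m + shift C)%MM | m <- msupp (phi C)].
  by apply/mapP; exists C; rewrite ?mem_enum.
by apply/mapP; exists m; rewrite ?mcoeff_msupp.
Qed.

End Multidegree.

End Symbolic.

(** * Comparison of two consecutive powers *)

Section Transfer.
Variables (K : fieldType) (n : nat) (H : hypergraph n).
Local Notation R := {mpoly K[n]}.
Implicit Types C : {set 'I_n}.

Lemma symbolic_homogeneous_chain N A t (c : {set 'I_n} -> K) C :
  (c C != 0 -> heavy H t (A - shift N C)%MM) -> symbolic_power H t (homogeneous_chain N A c C).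
Proof.
move=> hc m; rewrite /homogeneous_chain mcoeffZ mcoeffX; case: (_ =P m) => [<-|_].
  by rewrite mulr1.
by rewrite mulr0 eqxx.
Qed.

Lemma coefs_symbolic N A t (phi : {set 'I_n} -> R) C :
  symbolic_power H t (phi C) -> coefs N A phi C != 0 ->
  (shift N C <= A)%MM /\ heavy H t (A - shift N C)%MM.
Proof. by move=> h; rewrite /coefs; case: ifP => [CA /h|]; rewrite ?eqxx. Qed.

(** The assumptions say that the Koszul complexes of the two quotients, taken in
    multidegrees A and B, have the same basis elements e_C. A cycle, and a chain
    bounding it, can then be moved between them without changing scalars. *)
Lemma transfer_degree N A B t t' j (phi : {set 'I_n} -> R) :
  (forall C, (shift N C <= A)%MM = (shift N C <= B)%MM) ->
  (forall C, (shift N C <= A)%MM ->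
     heavy H t (A - shift N C)%MM = heavy H t' (B - shift N C)%MM) ->
  acyclic (@var_pow K n N) (symbolic_power H t') j ->
  supported j phi -> (forall C, symbolic_power H t (boundary (@var_pow K n N) phi C)) ->
  exists2 psi, supported j.+1 psi & forall C, symbolic_power H t
    (homogeneous_chain N A (coefs N A phi) C - boundary (@var_pow K n N) psi C).
Proof.
move=> AB hAB acj sphi cphi; set c := coefs N A phi.
have admA : admissible N A c by apply: admissible_coefs.
have admB : admissible N B c by move=> C; rewrite -AB; apply: admA.
have [C Cj|C|psi spsi psiP] := acj (homogeneous_chain N B c).
- by rewrite /homogeneous_chain /c /coefs sphi // mcoeff0 if_same scale0r.
- rewrite boundary_homogeneous_chain //; apply: symbolic_homogeneous_chain => nz.
  have := cphi C; move/(coefs_symbolic (N := N) (A := A)); rewrite coefs_boundary.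
  by case/(_ nz) => CA; rewrite hAB.
pose d := coefs N B psi.
have admd : admissible N A d by move=> C; rewrite AB; apply: admissible_coefs.
exists (homogeneous_chain N A d) => [C Cj|C].
  by rewrite /homogeneous_chain /d /coefs spsi // mcoeff0 if_same scale0r.
rewrite boundary_homogeneous_chain // /homogeneous_chain -scalerBl.
apply: (@symbolic_homogeneous_chain _ _ _ (fun C => c C - scalar_boundary d C)) => nz.
have := @coefs_symbolic N B t'
  (fun C => homogeneous_chain N B c C - boundary (@var_pow K n N) psi C) C (psiP C).
have -> : coefs N B (fun C => homogeneous_chain N B c C - boundary (@var_pow K n N) psi C) C
    = c C - scalar_boundary d C.
  rewrite /d -coefs_boundary -(coefs_homogeneous_chain admB C) /coefs.
  by case: ifP => _; rewrite ?subr0 // mcoeffB.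
by case/(_ nz) => CB; rewrite hAB ?AB.
Qed.

Lemma transfer_acyclic N t t' j :
  (forall A, exists B, (forall C, (shift N C <= A)%MM = (shift N C <= B)%MM) /\
    (forall C, (shift N C <= A)%MM ->
     heavy H t (A - shift N C)%MM = heavy H t' (B - shift N C)%MM)) ->
  acyclic (@var_pow K n N) (symbolic_power H t') j ->
  acyclic (@var_pow K n N) (symbolic_power H t) j.
Proof.
move=> AB acj phi sphi cphi.
have /functional_choice [psi psiP] : forall A, exists psi, supported j.+1 psi /\
    forall C, symbolic_power H t
      (homogeneous_chain N A (coefs N A phi) C - boundary (@var_pow K n N) psi C).
  move=> A; have [B [B1 B2]] := AB A.
  by have [psi] := transfer_degree B1 B2 acj sphi cphi; exists psi.
have [r ur rP] := exists_multidegrees N phi.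
exists (fun C => \sum_(A <- r) psi A C) => [C Cj|C].
  by apply: big1 => A _; rewrite (proj1 (psiP A)).
rewrite (coefs_sum ur rP) boundary_sum -sumrB; apply: ideal_sum => [|A _].
  exact: symbolic_power_is_ideal.
exact: (proj2 (psiP A)).
Qed.

(** Consider the exponent vector A - shift C on an edge E. A vertex of E outside C
    with t <= A i alone gives E weight at least t. If there is none, the vertices
    of E in C satisfy N <= A i, those outside C satisfy A i < t, and the exponent
    at i is a i in both cases, whatever C is. Adding to a one colour u0 of a
    colouring with t colours raises the weight of an edge by at most one if it
    was less than t and by at least one otherwise; so weight at least t before
    means weight at least t + 1 after. Vertices with t <= A i < N never belong
    to C, and the value t + 1 there gives weight t + 1 to the edges through them.
    The bound N = 2t + 1 exceeds t + 1 and all sums A i + u0 i with A i < t, so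
    that A and B admit the same sets C. *)
Lemma matching_multidegree (balH : balanced H) t (A : 'X_{1..n}) : (0 < t)%N ->
  let N := t.*2.+1 in exists B : 'X_{1..n},
    (forall C, (shift N C <= A)%MM = (shift N C <= B)%MM) /\
    (forall C, (shift N C <= A)%MM ->
     heavy H t (A - shift N C)%MM = heavy H t.+1 (B - shift N C)%MM).
Proof.
move=> t0 N.
(* Vertices with t <= A i < N get weight 0: the edges through them are settled
   by the value of B there. *)
pose a (i : 'I_n) := if (N <= A i)%N then (A i - N)%N else if (A i < t)%N then A i else 0%N.
have [u [ua uP]] := balanced_colouring balH a t0.
pose u0 := u (Ordinal t0).
have u0a i : (u0 i <= a i)%N by rewrite -ua (bigD1 (Ordinal t0)) //= leq_addr.
pose B := [multinom if (N <= A i)%N || (A i < t)%N then (A i + u0 i)%N else t.+1 | i < n].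
have BE i : B i = if (N <= A i)%N || (A i < t)%N then (A i + u0 i)%N else t.+1.
  by rewrite mnmE.
have NB i : (N <= A i)%N = (N <= B i)%N.
  rewrite BE; have := u0a i; rewrite /a.
  by case: (leqP N (A i)); case: (ltnP (A i) t) => /=; rewrite /N; lia.
exists B; split=> [C|C /shiftP CA].
  by apply/shiftP/shiftP => h i /h; rewrite NB.
rewrite /heavy; apply: eq_forallb_in => E EH.
have [/exists_inP [i iE /andP [iC tA]]|] :=
    boolP [exists i in E, (i \notin C) && (t <= A i)%N].
  have le_weight (m : 'X_{1..n}) : (m i <= weight m E)%N.
    by rewrite /weight (bigD1 i) //= leq_addr.
  transitivity true; [|apply/esym]; apply: leq_trans (le_weight _);
    rewrite mnmBE shiftE (negPf iC) muln0 subn0 //.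
  by rewrite BE; case: (leqP N (A i)); case: (ltnP (A i) t) => /=; rewrite /N; lia.
rewrite negb_exists_in => /forall_inP small.
have cellE i : i \in E -> (A - shift N C)%MM i = a i /\ (B - shift N C)%MM i = (a i + u0 i)%N.
  move=> iE; rewrite !mnmBE !shiftE BE /a; have := small i iE.
  case: (boolP (i \in C)) => [iC _|_] /=.
    by have NA := CA _ iC; rewrite NA /= muln1; lia.
  by rewrite -ltnNge muln0 !subn0 => h; rewrite h orbT; case: leqP => //; rewrite /N; lia.
have -> : weight (A - shift N C)%MM E = weight a E.
  by apply: eq_bigr => i /cellE [].
have -> : weight (B - shift N C)%MM E = (weight a E + weight u0 E)%N.
  by rewrite /weight -big_split; apply: eq_bigr => i /cellE [].
have [ge le] := uP E EH.
apply/idP/idP => [/[dup] ta /ge /(_ (Ordinal t0))|]; first by rewrite -/u0; lia.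
apply: contraTT; rewrite -!ltnNge => at_.
by have := le (ltnW at_) (Ordinal t0); rewrite -/u0; lia.
Qed.

Lemma acyclic_symbolicS (balH : balanced H) t j : (0 < t)%N ->
  let y := @var_pow K n t.*2.+1 in
  acyclic y (symbolic_power H t.+1) j -> acyclic y (symbolic_power H t) j.
Proof. by move=> t0 y; apply: transfer_acyclic => A; apply: matching_multidegree. Qed.

End Transfer.

(** * Depth through Koszul homology *)

Section Depth.
Variables (K : fieldType) (n : nat).
Local Notation R := {mpoly K[n]}.
Local Notation irr := (@irrelevant_ideal K n).
Implicit Types (I : R -> Prop) (s r : seq R) (f g : R).

Lemma irrelevant_is_ideal : is_ideal irr.
Proof. exact: span_is_ideal. Qed.

Lemma irrelevantX i : irr 'X_i.
Proof. by apply: mem_span; exists i. Qed.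

Lemma not_irrelevant1 : ~ irr 1.
Proof.
suff h f : irr f -> f@_0%MM = 0.
  by move/h/eqP; rewrite mcoeff1 eqxx oner_eq0.
apply: (@span_sub _ _ (fun f => f@_0%MM = 0)) => [|_ [i ->]]; last first.
  by rewrite mcoeffX mnm1_eq0.
split=> [|a b a0 b0|a b b0]; first by rewrite mcoeff0.
  by rewrite mcoeffD a0 b0 addr0.
by rewrite rmorphM /= b0 mulr0.
Qed.

Lemma irrelevant_mnm (m : 'X_{1..n}) : m != 0%MM -> irr 'X_[m].
Proof.
move=> m0; have [/existsP [i mi]|] := boolP [exists i, (0 < m i)%N].
  have le : (U_(i) <= m)%MM by rewrite lep1mP -lt0n.
  rewrite -(submK le) mpolyXD; apply: (idealMl irrelevant_is_ideal).
  exact: irrelevantX.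
rewrite negb_exists => /forallP h; case/eqP: m0; apply/mnmP => i.
by have := h i; rewrite -eqn0Ngt mnmE => /eqP.
Qed.

(** Modulo the N-th powers the variables are nilpotent, hence so is every element
    of the ideal they generate. *)
Lemma irrelevant_pow N f : irr f ->
  exists k (z : 'I_n -> R), f ^+ k = \sum_i z i * var_pow K N i.
Proof.
pose Y g := exists z : 'I_n -> R, g = \sum_i z i * var_pow K N i.
have HY : is_ideal Y.
  split=> [|a b [z ->] [w ->]|a b [z ->]].
  - by exists (fun=> 0); rewrite big1 // => i _; rewrite mul0r.
  - by exists (fun i => z i + w i); rewrite -big_split; apply: eq_bigr => i _; rewrite mulrDl.
  - by exists (fun i => a * z i); rewrite mulr_sumr; apply: eq_bigr => i _; rewrite mulrA.
move=> irrf; suff [k [z]] : nilpotent_on Y 1 f by rewrite mulr1; exists k, z.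
move: irrf; apply: span_sub => [|_ [i ->]]; first exact: nilpotent_on_is_ideal.
exists N, (fun j => (j == i)%:R); rewrite mulr1 (bigD1 i) //= eqxx mul1r big1 ?addr0 //.
by move=> j /negPf ->; rewrite mul0r.
Qed.

Lemma homogeneous_seq_rcons I s f : homogeneous_quotient_seq I (rcons s f) ->
  [/\ homogeneous_quotient_seq I s, irr f &
      forall g, ideal_adjoin I s (f * g) -> ideal_adjoin I s g].
Proof.
case=> hs [reg prop]; split.
- split; first by move=> g gs; apply: hs; rewrite mem_rcons inE gs orbT.
  split=> [j js g|]; last first.
    by move=> h1; apply: prop; rewrite adjoin_rcons; exists 0; rewrite mul0r subr0.
  have := reg j _ g; rewrite size_rcons ltnS (ltnW js) => /(_ isT).
  by rewrite nth_rcons js -cats1 takel_cat // ltnW.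
- by case: (hs f); rewrite ?mem_rcons ?mem_head.
move=> g; have := reg (size s) _ g; rewrite size_rcons ltnSn => /(_ isT).
by rewrite nth_rcons ltnn eqxx -cats1 take_size_cat.
Qed.

Lemma homogeneous_seq_extend I s f e :
  (forall g, I g -> irr g) -> homogeneous_quotient_seq I s -> irr f -> f \is e.-homog ->
  (forall g, ideal_adjoin I s (f * g) -> ideal_adjoin I s g) ->
  homogeneous_quotient_seq I (rcons s f).
Proof.
move=> Iirr [hs [reg prop]] irrf homf regf.
have hsf g : g \in rcons s f -> (exists d : nat, g \is d.-homog) /\ irr g.
  by rewrite mem_rcons inE => /orP [/eqP ->|/hs //]; split=> //; exists e.
split=> //; split=> [j|]; last first.
  move=> h1; apply: not_irrelevant1; move: h1; apply: adjoin_sub => //.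
    exact: irrelevant_is_ideal.
  by move=> g /hsf [].
rewrite size_rcons ltnS leq_eqVlt => /orP [/eqP ->|js] g.
  by rewrite nth_rcons ltnn eqxx -cats1 take_size_cat //; apply: regf.
by rewrite nth_rcons js -cats1 takel_cat ?(ltnW js) //; apply: reg.
Qed.

(** Each element of the sequence shifts the Koszul homology by one degree. *)
Lemma acyclic_from_regular_seq N I s j : is_ideal I -> homogeneous_quotient_seq I s ->
  acyclic_from (@var_pow K n N) I j <->
  acyclic_from (@var_pow K n N) (ideal_adjoin I s) (j + size s).
Proof.
move=> HI; elim/last_ind: s => [|s f IHs]; first by rewrite adjoin_nil // addn0.
case/homogeneous_seq_rcons => /IHs -> irrf regf; rewrite adjoin_rcons size_rcons addnS.
have [k [z fk]] := irrelevant_pow N irrf.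
exact: acyclic_from_adjoin1 (adjoin_is_ideal I s) regf fk.
Qed.

(** A longer sequence would force H_0(R/I) = 0, and 1 would lie in the irrelevant
    ideal. *)
Lemma size_regular_seq I s : is_ideal I -> (forall g, I g -> irr g) ->
  homogeneous_quotient_seq I s -> (size s <= n)%N.
Proof.
move=> HI Iirr hs; rewrite leqNgt; apply/negP => ns; apply: not_irrelevant1.
have ac0 : acyclic_from (@var_pow K n 1) I 0.
  apply/(acyclic_from_regular_seq 1 0 HI hs) => j sj.
  exact: (acyclic_from_large (adjoin_is_ideal I s)) (leq_trans ns sj).
apply: (@not_acyclic0 _ _ (@var_pow K n 1) I) => //.
- exact: irrelevant_is_ideal.
- by move=> i; rewrite /var_pow expr1; apply: irrelevantX.
- exact: ac0.
- exact: ideal0.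
Qed.

(** Induction on the sum of the exponents e i with y i ^ e i * g in L: replacing g
    by y i * g lowers one of them. *)
Lemma socle_free_saturated L (y : 'I_n -> R) : is_ideal L ->
  (forall g, (forall i, L (y i * g)) -> L g) ->
  forall g, (forall i, saturation L (y i) g) -> L g.
Proof.
move=> HL top g /fin_all_exists [e eP].
have [m] := ubnP (\sum_i e i); elim: m e g eP => // m IHm e g eP; rewrite ltnS => em.
have [/existsP [i /eqP ei]|] := boolP [exists i, e i == 0%N].
  by have := eP i; rewrite ei mul1r.
rewrite negb_exists => /forallP e0; apply: top => i.
apply: (IHm (fun j => if j == i then (e i).-1 else e j)) => [j|].
  case: eqP => [->|_]; last by rewrite mulrCA; apply: idealMl.
  by rewrite mulrA -exprSr prednK ?lt0n.
apply: leq_trans em; rewrite (bigD1 i) //= [X in (_ < X)%N](bigD1 i) //= eqxx.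
rewrite -addSn prednK ?lt0n // leq_add2l; apply: leq_sum => j /negPf -> //.
Qed.

(** Avoidance yields a form f such that an element multiplied into L by f is
    multiplied into L by powers of all the variables; by the vanishing of H_n it
    lies in L. *)
Lemma exists_regular_element L N : (0 < n)%N -> (0 < N)%N -> is_ideal L ->
  acyclic (@var_pow K n N) L n ->
  exists f e, [/\ irr f, f \is e.-homog & forall g, L (f * g) -> L g].
Proof.
move=> n0 N0 HL acL.
have [||f [e [_ irrf homf fP]]] :=
    @saturation_avoidance K n L irr [seq 'X_i | i : 'I_n] HL irrelevant_is_ideal.
- by rewrite -size_eq0 size_map -cardE card_ord -lt0n.
- move=> _ /mapP [i _ ->]; split; first exact: irrelevantX.
  by rewrite dhomogX /= mdeg1.
exists f, e; split=> // g Lfg.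
apply: (@socle_free_saturated L (@var_pow K n N)) => // [h|i].
  exact: acyclic_top.
have [||k Lk] := fP g _ 'X_i; first by exists 1%N.
  by apply/mapP; exists i; rewrite ?mem_enum.
exists k; rewrite /var_pow -exprM -(subnK (leq_pmull k N0)) exprD -mulrA.
exact: idealMl.
Qed.

(** Sequences have length at most n, so prolonging the empty one has to stop. *)
Lemma depth_quotientP I : is_ideal I -> (forall g, I g -> irr g) ->
  exists2 s, maximal_homogeneous_quotient_seq I s & size s = depth_quotient I.
Proof.
move=> HI Iirr; apply: (epsilon_spec (inhabits 0%N)
  (fun d => exists2 s, maximal_homogeneous_quotient_seq I s & size s = d)).
suff [s smax] : exists s, maximal_homogeneous_quotient_seq I s by exists (size s), s.
apply: NNPP => none.
have [s hs ss] : exists2 s, homogeneous_quotient_seq I s & size s = n.+1.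
  elim: n.+1 => [|k [s hs sk]].
    exists [::] => //; split=> //; split=> //.
    by rewrite adjoin_nil // => /Iirr; apply: not_irrelevant1.
  apply: NNPP => noext; apply: none; exists s; split=> // f hsf; apply: noext.
  by exists (rcons s f); rewrite ?size_rcons ?sk.
by have := size_regular_seq HI Iirr hs; rewrite ss ltnn.
Qed.

End Depth.

Section CoverIdealProper.
Variables (K : fieldType) (n : nat) (H : hypergraph n).
Hypothesis edges_neq0 : edges H != set0.

Lemma symbolic_irrelevant t f : (0 < t)%N -> symbolic_power H t f ->
  @irrelevant_ideal K n f.
Proof.
move=> t0 fP; have [E EH] := set0Pn _ edges_neq0.
rewrite [f]mpolyE; apply: ideal_sum_in => [|m]; first exact: irrelevant_is_ideal.
rewrite mcoeff_msupp => /fP /forall_inP /(_ E EH) hE.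
rewrite -mul_mpolyC; apply: (idealMl (irrelevant_is_ideal _ _)); apply: irrelevant_mnm.
apply: contraTneq hE => ->; rewrite -ltnNge /weight big1 // => i _; exact: mnm0E.
Qed.

Lemma vertices_gt0 : (0 < n)%N.
Proof.
have [E EH] := set0Pn _ edges_neq0.
have /set0Pn [i _] : E != set0 by apply: contraNneq (edges_nonempty H) => <-.
exact: leq_ltn_trans (leq0n i) (ltn_ord i).
Qed.

End CoverIdealProper.

Theorem theorem2p4 (K : fieldType) (n : nat) (H : hypergraph n)
    (edges_neq0 : edges H != set0) (balancedH : balanced H)
    (t : nat) (t_ge1 : (1 <= t)%N) :
  (depth_quotient (ideal_pow (cover_ideal K H) t) >=
   depth_quotient (ideal_pow (cover_ideal K H) t.+1))%N.
Proof.
rewrite !cover_pow_symbolic //.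
have HI u := symbolic_power_is_ideal K H u.
have irrI u (u0 : (0 < u)%N) g := @symbolic_irrelevant K n H edges_neq0 u g u0.
have [s [hs smax] <-] := depth_quotientP (HI t) (irrI t t_ge1).
have [r [hr _] <-] := depth_quotientP (HI t.+1) (irrI t.+1 (ltn0Sn t)).
(* If s were shorter than r, the homology of R/J^t would vanish from degree
   n + 1 - size r <= n - size s on, and s would not be maximal. *)
rewrite leqNgt; apply/negP => lt_sr.
have le_rn := size_regular_seq (HI _) (irrI t.+1 (ltn0Sn t)) hr.
pose N := t.*2.+1; pose j := (n.+1 - size r)%N.
have ac_r : acyclic_from (@var_pow K n N) (symbolic_power H t.+1) j.
  apply/(acyclic_from_regular_seq N j (HI _) hr).
  by rewrite /j subnK ?leqW //; apply/acyclic_from_large/adjoin_is_ideal.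
have ac_s : acyclic_from (@var_pow K n N) (symbolic_power H t) j.
  by move=> i ji; apply: acyclic_symbolicS => //; apply: ac_r.
have [|f [e [irrf homf regf]]] := exists_regular_element (vertices_gt0 edges_neq0)
    (ltn0Sn _) (adjoin_is_ideal (symbolic_power H t) s) (N := N).
  apply: (proj1 (acyclic_from_regular_seq N j (HI _) hs) ac_s).
  by rewrite /j; lia.
apply: (smax f); exact: homogeneous_seq_extend (irrI t t_ge1) hs irrf homf regf.
Qed.
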